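(* Let $X$ be a Hilbert space, let $(T(t))_{t\ge0}$ be the strongly continuous semigroup of contractions on $X$ generated by $(A,D(A))$, let $A_1\in\mathcal{L}(X)$ and $\Psi f:=A_1f(-1)$ for $f\in H^1([-1,0],X)$. Let $(\mathcal{T}_0(t))_{t\ge0}$ be the semigroup on $\mathcal{X}=X\times L^2([-1,0],X)$ generated by $(\mathcal{A}_0,D(\mathcal{A}_0))$ and let $\mathcal{A}_\Psi$ be the perturbing operator (both operators as defined in the context). Then the semigroup $(\mathcal{T}(t))_{t\ge0}$ generated by $(\mathcal{A}_0+\mathcal{A}_\Psi,D(\mathcal{A}_0))$ satisfies $$\|\mathcal{T}(t)\|\le e^{\frac12 t}\big(1+\|A_1\|\,M\,t^{\frac12}\big)\qquad\forall t\in[0,1],$$ for a constant $M$ with $M\le\sqrt2\,e^{2\|A_1\|^2}$.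
   Context: $H^1([-1,0],X)=W^{1,2}([-1,0],X)$; values such as $f(-1)$, $f(0)$ are those of the continuous representative. $\mathcal{X}:=X\times L^2([-1,0],X)$ is a Hilbert space with norm $\|\binom{x}{f}\|_{\mathcal X}^2=\|x\|_X^2+\|f\|_{L^2}^2$. The operators are $$\mathcal{A}_0:=\begin{pmatrix}A&0\\0&\frac{d}{d\sigma}\end{pmatrix},\qquad D(\mathcal{A}_0):=\Big\{\tbinom{x}{f}\in D(A)\times H^1([-1,0],X): f(0)=x\Big\},$$ $$\mathcal{A}_\Psi:=\begin{pmatrix}0&\Psi\\0&0\end{pmatrix}\in\mathcal{L}\big(X\times H^1([-1,0],X),\mathcal{X}\big).$$ It is known that $(\mathcal{A}_0,D(\mathcal{A}_0))$ and $(\mathcal{A}_0+\mathcal{A}_\Psi,D(\mathcal{A}_0))$ generate strongly continuous semigroups on $\mathcal{X}$. *)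

(* Defs.v *)
From HB Require Import structures.
From mathcomp Require Import all_boot all_order all_algebra ring_quotient.
From mathcomp Require Import all_classical all_reals all_analysis.
From mathcomp Require Import measurable_realfun ring.
Set Implicit Arguments.
Unset Strict Implicit.
Unset Printing Implicit Defensive.
Import Order.TTheory GRing.Theory Num.Theory.
Import numFieldNormedType.Exports.
Local Open Scope classical_set_scope.
Local Open Scope ring_scope.
Local Open Scope quotient_scope.

Section Operators.
Context {R : realType}.
Implicit Types V W : normedModType R.

Definition opnorm V W (F : V -> W) : R :=
  sup [set `|F x| | x in [set x : V | `|x| <= 1]].

Record C0_semigroup V (T : R -> {linear V -> V}) : Prop := {
  C0_bounded : forall t, 0 <= t -> continuous (T t);
  C0_id : forall x, T 0 x = x;
  C0_add : forall s t x, 0 <= s -> 0 <= t -> T (s + t) x = T s (T t x);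
  C0_continuous : forall x,
    {within [set t | 0 <= t], continuous (fun t => T t x)}
}.

(* With completeness of [V], this says that [V] is a Hilbert space.  Scalars are
   real: a complex Hilbert space is covered through its underlying real one, with
   inner product the real part.  This loses nothing, since complex-linear maps are
   real-linear and neither norms, generators nor Sobolev spaces involve the
   scalar field. *)
Definition norm_of_dot V (dot : {dot V for idfun}) :=
  forall x : V, `|x| ^+ 2 = dot x x.

(* An unbounded operator is a pair [(D, A)] with [D] its domain; the values of
   [A] outside [D] are irrelevant. *)
Definition generates V (T : R -> {linear V -> V}) (D : set V) (A : V -> V) :=
  forall x y, (D x /\ A x = y) <->
    h^-1 *: (T h x - x) @[h --> 0^'+] --> y.

End Operators.

Section Bochner.
Context {d : measure_display} {T : measurableType d} {R : realType}.
Context {X : normedModType R}.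
Variables (mu : {measure set T -> \bar R}) (D : set T).
Implicit Types (s f : T -> X).

Definition is_simple s :=
  finite_set (range s) /\ forall x, measurable (s @^-1` [set x]).

Definition simple_integral s : X :=
  \sum_(x \in range s) fine (mu (D `&` s @^-1` [set x])) *: x.

Definition strongly_measurable f :=
  exists2 s_ : nat -> T -> X, forall n, is_simple (s_ n) &
    forall t, D t -> s_ n t @[n --> \oo] --> f t.

(* [f] is Bochner integrable on [D] with integral [v] ([D] of finite measure). *)
Definition is_bochner f (v : X) :=
  exists s_ : nat -> T -> X,
    [/\ forall n, is_simple (s_ n),
        forall t, D t -> s_ n t @[n --> \oo] --> f t,
        (\int[mu]_(t in D) (`|f t - s_ n t|)%:E @[n --> \oo] --> 0)%E &
        simple_integral (s_ n) @[n --> \oo] --> v].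

Lemma is_simple_comp2 (g : X -> X -> X) s1 s2 :
  is_simple s1 -> is_simple s2 -> is_simple (fun t => g (s1 t) (s2 t)).
Proof.
move=> [f1 m1] [f2 m2]; split.
  apply: (@sub_finite_set _ _ ((fun p => g p.1 p.2) @` (range s1 `*` range s2))).
    by move=> _ [t _ <-]; exists (s1 t, s2 t) => //=; split; exists t.
  by apply: finite_image; exact: finite_setX.
move=> x; rewrite (_ : _ @^-1` _ =
  \bigcup_(p in (range s1 `*` range s2) `&` [set p | g p.1 p.2 = x])
    (s1 @^-1` [set p.1] `&` s2 @^-1` [set p.2])).
  apply: fin_bigcup_measurable.
    by apply: finite_setIl; exact: finite_setX.
  by move=> p _; exact: measurableI.
apply/seteqP; split=> t /=.
  move=> gx; exists (s1 t, s2 t) => //=.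
  by split => //; split; exists t.
by move=> [p [_ /= <-] [-> ->]].
Qed.

Lemma measurable_norm_simple s : is_simple s ->
  measurable_fun setT (fun t => `|s t|).
Proof.
move=> [fs ms] _ B mB; rewrite setTI (_ : _ @^-1` _ =
  \bigcup_(x in range s `&` [set x | B `|x|]) (s @^-1` [set x])).
  by apply: fin_bigcup_measurable => //; exact: finite_setIl.
apply/seteqP; split=> t /=.
  by move=> Bt; exists (s t) => //; split => //; exists t.
by move=> [x [_ /= Bx] ->].
Qed.

Lemma strongly_measurable_comp2 (g : X -> X -> X) f1 f2 :
  continuous (fun p : X * X => g p.1 p.2) ->
  strongly_measurable f1 -> strongly_measurable f2 ->
  strongly_measurable (fun t => g (f1 t) (f2 t)).
Proof.
move=> cg [s1 ss1 c1] [s2 ss2 c2].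
exists (fun n t => g (s1 n t) (s2 n t)); first by move=> n; exact: is_simple_comp2.
move=> t Dt.
apply: (@continuous2_cvg _ _ _ _ _ _ (fun n => s1 n t) (fun n => s2 n t) g).
- exact: (cg (f1 t, f2 t)).
- exact: c1.
- exact: c2.
Qed.

Lemma strongly_measurable_norm f : measurable D ->
  strongly_measurable f -> measurable_fun D (fun t => `|f t|).
Proof.
move=> mD [s_ ss cs].
apply: (@measurable_fun_cvg _ _ _ _ (fun n t => `|s_ n t|)).
  by move=> n; apply: measurable_funTS; exact: measurable_norm_simple.
by move=> t Dt; apply: cvg_norm; exact: cs.
Qed.

Lemma strongly_measurable0 : strongly_measurable (fun=> 0).
Proof.
exists (fun _ _ => 0); last by move=> t _; exact: cvg_cst.
move=> _; split.
  by apply: (@sub_finite_set _ _ [set 0]) => // _ [t _ <-].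
move=> x; have [<-|/eqP x0] := eqVneq 0 x.
  by rewrite (_ : _ @^-1` _ = setT)//; apply/seteqP; split.
by rewrite (_ : _ @^-1` _ = set0)//; apply/seteqP; split => // t /=.
Qed.

End Bochner.

Section L2.
Context {R : realType} (X : normedModType R).
Local Notation mu := (@lebesgue_measure R).
Local Notation I := (`[-1, 0]%classic : set R).
Implicit Types (f g : R -> X).

Definition L2sqnorm f : \bar R := (\int[mu]_(t in I) (`|f t| ^+ 2)%:E)%E.

(* Strong measurability is meant everywhere on [-1,0]; up to a.e. equality this
   is the same as requiring simple functions to converge a.e. *)
Definition L2pred : {pred R -> X} :=
  mem [set f | strongly_measurable I f /\ (L2sqnorm f < +oo)%E].

Lemma L2predP f : reflect (strongly_measurable I f /\ (L2sqnorm f < +oo)%E)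
  (f \in L2pred).
Proof. by apply: (iffP idP); rewrite inE. Qed.

Let mI : measurable I. Proof. exact: measurable_itv. Qed.

Lemma measurable_L2 f : strongly_measurable I f ->
  measurable_fun I (fun t => (`|f t| ^+ 2)%:E : \bar R).
Proof.
move=> mf; apply/measurable_EFinP.
by apply: measurable_funX; exact: strongly_measurable_norm.
Qed.

Lemma L2sqnorm_ge0 f : (0 <= L2sqnorm f)%E.
Proof. by apply: integral_ge0 => t _; rewrite lee_fin sqr_ge0. Qed.

Lemma strongly_measurableD f g : strongly_measurable I f ->
  strongly_measurable I g -> strongly_measurable I (f + g).
Proof.
apply: (strongly_measurable_comp2 (g := fun x y => x + y)) => p.
by apply: cvgD; [exact: cvg_fst|exact: cvg_snd].
Qed.

Lemma strongly_measurableZ a f : strongly_measurable I f ->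
  strongly_measurable I (a *: f).
Proof.
move=> mf.
apply: (strongly_measurable_comp2 (g := fun x _ => a *: x) _ mf mf) => p.
by apply: cvgZr; exact: cvg_fst.
Qed.

Lemma L2sqnormZ a f : strongly_measurable I f ->
  L2sqnorm (a *: f) = ((a ^+ 2)%:E * L2sqnorm f)%E.
Proof.
move=> mf; rewrite /L2sqnorm -ge0_integralZl//.
- apply: eq_integral => t _; rewrite -EFinM; congr EFin.
  by change (`|a *: f t| ^+ 2 = a ^+ 2 * `|f t| ^+ 2);
    rewrite normrZ exprMn real_normK ?num_real.
- exact: measurable_L2.
- by rewrite lee_fin sqr_ge0.
Qed.

Lemma L2sqnormD f g (r : R) : 0 < r -> strongly_measurable I f ->
  strongly_measurable I g ->
  (L2sqnorm (f + g)%R <=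
   (1 + r)%:E * L2sqnorm f + (1 + r^-1)%:E * L2sqnorm g)%E.
Proof.
move=> r0 mf mg.
have mf2 := measurable_L2 mf; have mg2 := measurable_L2 mg.
have a0 : 0 <= 1 + r by rewrite addr_ge0// ltW.
have b0 : 0 <= 1 + r^-1 by rewrite addr_ge0// invr_ge0 ltW.
have sq0 (h : R -> X) t : (0 <= (`|h t| ^+ 2)%:E)%E by rewrite lee_fin sqr_ge0.
rewrite /L2sqnorm -!ge0_integralZl// -ge0_integralD//; last 4 first.
- by move=> t _; rewrite mule_ge0.
- exact: measurable_funeM.
- by move=> t _; rewrite mule_ge0.
- exact: measurable_funeM.
apply: ge0_le_integral => //.
- by apply: measurable_L2; apply: strongly_measurableD.
- by apply: emeasurable_funD; exact: measurable_funeM.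
move=> t _ /=; rewrite -!EFinM -EFinD lee_fin.
apply: (@le_trans _ _ ((`|f t| + `|g t|) ^+ 2)).
  by rewrite lerXn2r ?nnegrE ?addr_ge0// ler_normD.
move: (`|f t|) (`|g t|) => x y; rewrite -subr_ge0.
rewrite (_ : _ - _ = r * (x - r^-1 * y) ^+ 2); last by field; rewrite gt_eqF.
by rewrite mulr_ge0 ?sqr_ge0// ltW.
Qed.

Lemma L2pred_closed : submod_closed L2pred.
Proof.
split.
  apply/L2predP; split; first exact: strongly_measurable0.
  rewrite /L2sqnorm integral0_eq// => t _.
  by rewrite normr0 expr0n.
move=> a f g /L2predP[mf ff] /L2predP[mg fg].
have maf := strongly_measurableZ a mf.
apply/L2predP; split; first exact: strongly_measurableD.
apply: le_lt_trans (L2sqnormD ltr01 maf mg) _.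
rewrite L2sqnormZ//; apply: lte_add_pinfty; apply: lte_mul_pinfty => //.
by apply: lte_mul_pinfty => //; rewrite lee_fin sqr_ge0.
Qed.

HB.instance Definition _ := GRing.isSubmodClosed.Build R (R -> X) L2pred
  L2pred_closed.

Record L2fun := MkL2fun { L2val :> R -> X ; L2valP : L2val \in L2pred }.

HB.instance Definition _ := [isSub for L2val].
HB.instance Definition _ := [Choice of L2fun by <:].
HB.instance Definition _ := [SubChoice_isSubLmodule of L2fun by <:].

Definition L2null : {pred L2fun} :=
  mem [set f : L2fun | {ae mu, forall t, I t -> f t = 0}].

Lemma L2nullP (f : L2fun) :
  reflect {ae mu, forall t, I t -> f t = 0} (f \in L2null).
Proof. by apply: (iffP idP); rewrite inE. Qed.

Lemma L2null_closed : submod_closed L2null.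
Proof.
split; first by apply/L2nullP; apply: aeW => t _.
move=> a f g /L2nullP f0 /L2nullP g0; apply/L2nullP.
have FF := ae_filter_ringOfSetsType mu.
apply: filterS2 f0 g0 => t ft gt It.
change (a *: f t + g t = 0).
by rewrite ft// gt// scaler0 addr0.
Qed.

HB.instance Definition _ := GRing.isSubmodClosed.Build R L2fun L2null
  L2null_closed.

Definition L2 : Type := Quotient.quot L2null.
HB.instance Definition _ := GRing.Zmodule.on L2.
HB.instance Definition _ := EqQuotient.on L2.

Definition L2class (f : L2fun) : L2 := \pi_L2 f.

Definition L2rep (u : L2) : L2fun := repr u.

Lemma L2repK u : L2class (L2rep u) = u. Proof. exact: reprK. Qed.

Lemma L2classP (f g : L2fun) :
  L2class f = L2class g <-> {ae mu, forall t, I t -> f t = g t}.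
Proof.
rewrite (_ : L2class f = L2class g <-> f - g \in L2null); last first.
  by rewrite Quotient.idealrBE; split => /eqP.
have FF := ae_filter_ringOfSetsType mu.
split => [/L2nullP|] fg; last apply/L2nullP; apply: filterS fg => t h It.
  by apply/eqP; rewrite -subr_eq0; apply/eqP; exact: h.
by change (f t - g t = 0); rewrite h// subrr.
Qed.

Lemma L2rep_ae (f : L2fun) : {ae mu, forall t, I t -> L2rep (L2class f) t = f t}.
Proof. by apply/L2classP; rewrite L2repK. Qed.

Lemma L2classD (f g : L2fun) : L2class (f + g) = L2class f + L2class g.
Proof. by rewrite /L2class (@Quotient.pi_add L2fun L2null). Qed.

Definition L2scale a (u : L2) : L2 := L2class (a *: L2rep u).

Lemma L2classZ a (f : L2fun) : L2class (a *: f) = L2scale a (L2class f).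
Proof.
apply/L2classP; have FF := ae_filter_ringOfSetsType mu.
apply: filterS (L2rep_ae f) => t h It.
by change (a *: f t = a *: L2rep (L2class f) t); rewrite h.
Qed.

Fact L2scaleA a b u : L2scale a (L2scale b u) = L2scale (a * b) u.
Proof. by rewrite -[u]L2repK -!L2classZ scalerA. Qed.

Fact L2scale1 : left_id 1 L2scale.
Proof. by move=> u; rewrite -[u]L2repK -L2classZ scale1r. Qed.

Fact L2scaleDr : right_distributive L2scale +%R.
Proof.
by move=> a u v; rewrite -[u]L2repK -[v]L2repK -L2classD -!L2classZ -L2classD
  scalerDr.
Qed.

Fact L2scaleDl u : {morph L2scale^~ u : a b / a + b}.
Proof. by move=> a b; rewrite -[u]L2repK -!L2classZ -L2classD scalerDl. Qed.

HB.instance Definition _ := GRing.Zmodule_isLmodule.Build R L2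
  L2scaleA L2scale1 L2scaleDr L2scaleDl.

Definition L2norm (u : L2) : R := Num.sqrt (fine (L2sqnorm (L2rep u))).

Lemma L2fun_measurable (f : L2fun) : strongly_measurable I f.
Proof. by have /L2predP[] := L2valP f. Qed.

Lemma L2sqnorm_fin (f : L2fun) : L2sqnorm f \is a fin_num.
Proof.
by have /L2predP[_ ?] := L2valP f; rewrite ge0_fin_numE// L2sqnorm_ge0.
Qed.

Lemma L2norm_class (f : L2fun) : L2norm (L2class f) = Num.sqrt (fine (L2sqnorm f)).
Proof.
congr (Num.sqrt (fine _)); apply: ae_eq_integral => //.
- by apply: measurable_L2; apply: L2fun_measurable.
- by apply: measurable_L2; apply: L2fun_measurable.
- have FF := ae_filter_ringOfSetsType mu.
  by apply: filterS (L2rep_ae f) => t h It; rewrite h.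
Qed.

Lemma L2norm_ge0 u : 0 <= L2norm u. Proof. exact: sqrtr_ge0. Qed.

Lemma sqr_L2norm u : L2norm u ^+ 2 = fine (L2sqnorm (L2rep u)).
Proof. by rewrite sqr_sqrtr// fine_ge0// L2sqnorm_ge0. Qed.

Fact ler_L2normD u v : L2norm (u + v) <= L2norm u + L2norm v.
Proof.
have -> : u + v = L2class (L2rep u + L2rep v) by rewrite L2classD !L2repK.
rewrite L2norm_class.
set f := L2rep u; set g := L2rep v; set c := Num.sqrt _.
have key r : 0 < r ->
    c ^+ 2 <= (1 + r) * L2norm u ^+ 2 + (1 + r^-1) * L2norm v ^+ 2.
  move=> r0; rewrite sqr_sqrtr; last by rewrite fine_ge0// L2sqnorm_ge0.
  rewrite !sqr_L2norm -lee_fin EFinD !EFinM !fineK ?L2sqnorm_fin//.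
  exact: L2sqnormD (L2fun_measurable f) (L2fun_measurable g).
apply/ler_addgt0Pr => e e0; set d := e / 2.
have d0 : 0 < d by rewrite divr_gt0.
have [u0 v0] := (L2norm_ge0 u, L2norm_ge0 v).
set a := L2norm u + d; set b := L2norm v + d.
have a0 : 0 < a by rewrite ltr_wpDl.
have b0 : 0 < b by rewrite ltr_wpDl.
rewrite (_ : _ + e = a + b); last by rewrite /a /b /d; field.
have ab : 0 <= a + b by rewrite ltW// addr_gt0.
rewrite -(@ler_pXn2r _ 2%N)// ?nnegrE ?sqrtr_ge0//.
apply: le_trans (key (b / a) (divr_gt0 b0 a0)) _.
rewrite (_ : (a + b) ^+ 2 = (1 + b / a) * a ^+ 2 + (1 + (b / a)^-1) * b ^+ 2);
  last by field; rewrite !gt_eqF.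
have [ba0 ab0] := (divr_gt0 b0 a0, divr_gt0 a0 b0).
rewrite invf_div lerD// ler_wpM2l ?addr_ge0 ?(ltW ba0) ?(ltW ab0)//.
  by rewrite lerXn2r ?nnegrE ?(ltW a0)// lerDl ltW.
by rewrite lerXn2r ?nnegrE ?(ltW b0)// lerDl ltW.
Qed.

Fact L2normZ a u : L2norm (a *: u) = `|a| * L2norm u.
Proof.
change (L2norm (L2class (a *: L2rep u)) = `|a| * L2norm u).
rewrite L2norm_class (L2sqnormZ a (L2fun_measurable _)).
by rewrite fineM ?L2sqnorm_fin//= sqrtrM ?sqr_ge0// sqrtr_sqr.
Qed.

Fact L2norm0_eq0 u : L2norm u = 0 -> u = 0.
Proof.
move=> /(congr1 (fun x => x ^+ 2)); rewrite sqr_L2norm expr0n/= => u0.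
have : (\int[mu]_(t in I) `|(`|L2rep u t| ^+ 2)%:E| = 0)%E.
  have <- : L2sqnorm (L2rep u) = 0%E by rewrite -(fineK (L2sqnorm_fin _)) u0.
  by apply: eq_integral => t _; rewrite gee0_abs// lee_fin sqr_ge0.
have [h _] := ae_eq_integral_abs mu mI (measurable_L2 (L2fun_measurable (L2rep u))).
move=> /h{}h.
have <- : L2class 0 = 0 by apply: (addrI (L2class 0)); rewrite -L2classD !addr0.
rewrite -[LHS]L2repK.
apply/L2classP; have FF := ae_filter_ringOfSetsType mu.
apply: filterS h => t h It.
have /eqP := h It; rewrite eqe sqrf_eq0 normr_eq0 => /eqP ->.
by [].
Qed.

HB.instance Definition _ := Lmodule_isNormed.Build R L2
  ler_L2normD L2normZ L2norm0_eq0.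

End L2.

Section H1.
Context {R : realType} {X : normedModType R}.
Local Notation mu := (@lebesgue_measure R).
Local Notation I := (`[-1, 0]%classic : set R).
Implicit Types f g : L2 X.

(* Test functions are of class C^1 with compact support in the open interval
   ]-1, 0[; by mollification they define the same weak derivatives as smooth
   ones. *)
Definition test_function (phi : R -> R) :=
  [/\ forall t, derivable phi t 1,
      continuous (derive1 phi) &
      exists a b, [/\ -1 < a, b < 0 & forall t, phi t != 0 -> a <= t <= b]].

(* \int phi' f = - \int phi g for all test functions phi *)
Definition weak_derivative f g :=
  forall phi, test_function phi -> exists v : X,
    is_bochner mu I (fun t => derive1 phi t *: L2rep f t) v /\
    is_bochner mu I (fun t => phi t *: L2rep g t) (- v).

Definition H1 : set (L2 X) := [set f | exists g, weak_derivative f g].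

Definition H1_deriv f : L2 X := xget 0 [set g | weak_derivative f g].

(* the continuous representative of [f] exists and takes the value [x] at [s] *)
Definition value_at f (s : R) (x : X) :=
  exists fc : R -> X,
    [/\ {within I, continuous fc},
        {ae mu, forall t, I t -> L2rep f t = fc t} & fc s = x].

Definition H1_eval f (s : R) : X := xget 0 [set x | value_at f s x].

End H1.

Section DelaySpace.
Context {R : realType} (X : normedModType R).

(* An alias, since the library norms [X * L2 X] by the maximum. *)
Definition delay_space : Type := (X * L2 X)%type.

HB.instance Definition _ := GRing.Lmodule.copy delay_space (X * L2 X)%type.

Definition delay_norm (u : delay_space) : R :=
  Num.sqrt (`|u.1| ^+ 2 + `|u.2| ^+ 2).

Fact ler_delay_normD u v : delay_norm (u + v) <= delay_norm u + delay_norm v.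
Proof.
pose a := `|u.1|; pose b := `|u.2|; pose c := `|v.1|; pose d := `|v.2|.
have [a0 b0 c0 d0] : [/\ 0 <= a, 0 <= b, 0 <= c & 0 <= d].
  by split; exact: normr_ge0.
have s0 (x y : R) : 0 <= x ^+ 2 + y ^+ 2 by rewrite addr_ge0 ?sqr_ge0.
apply: (@le_trans _ _ (Num.sqrt ((a + c) ^+ 2 + (b + d) ^+ 2))).
  rewrite ler_sqrt//; apply: lerD.
    by rewrite lerXn2r ?nnegrE ?addr_ge0//; exact: ler_normD.
  by rewrite lerXn2r ?nnegrE ?addr_ge0//; exact: ler_normD.
rewrite /delay_norm -/a -/b -/c -/d; clearbody a b c d.
rewrite -(@ler_pXn2r _ 2%N)// ?nnegrE ?addr_ge0 ?sqrtr_ge0//.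
rewrite [leLHS]sqr_sqrtr// [leRHS]sqrrD !sqr_sqrtr// -sqrtrM//.
have h : a * c + b * d <= Num.sqrt ((a ^+ 2 + b ^+ 2) * (c ^+ 2 + d ^+ 2)).
  rewrite -[leLHS]ger0_norm ?addr_ge0 ?mulr_ge0// -sqrtr_sqr.
  rewrite ler_sqrt ?mulr_ge0// -subr_ge0.
  rewrite (_ : _ - _ = (a * d - b * c) ^+ 2); last by ring.
  exact: sqr_ge0.
rewrite (_ : (a + c) ^+ 2 + _ =
  a ^+ 2 + b ^+ 2 + (a * c + b * d) *+ 2 + (c ^+ 2 + d ^+ 2)); last by ring.
by rewrite lerD2r lerD2l lerMn2r.
Qed.

Fact delay_normZ a u : delay_norm (a *: u) = `|a| * delay_norm u.
Proof.
rewrite /delay_norm !normrZ !exprMn -mulrDr sqrtrM ?sqr_ge0//.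
by rewrite sqrtr_sqr normr_id.
Qed.

Fact delay_norm0_eq0 u : delay_norm u = 0 -> u = 0.
Proof.
move=> /eqP; rewrite sqrtr_eq0 => u0.
have : `|u.1| ^+ 2 + `|u.2| ^+ 2 == 0 by rewrite eq_le u0 addr_ge0 ?sqr_ge0.
rewrite paddr_eq0 ?sqr_ge0// !sqrf_eq0 !normr_eq0 => /andP[/eqP u1 /eqP u2].
by rewrite [u]surjective_pairing u1 u2.
Qed.

HB.instance Definition _ := Lmodule_isNormed.Build R delay_space
  ler_delay_normD delay_normZ delay_norm0_eq0.

Definition delay_domain (D : set X) : set delay_space :=
  [set u | [/\ D u.1, H1 u.2 & value_at u.2 0 u.1]].

Definition delay_A0 (A : X -> X) (u : delay_space) : delay_space :=
  (A u.1, H1_deriv u.2).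

Definition delay_APsi (Psi : L2 X -> X) (u : delay_space) : delay_space :=
  (Psi u.2, 0).

Definition delay_Psi (A1 : X -> X) (f : L2 X) : X := A1 (H1_eval f (-1)).

End DelaySpace.

(* Main.v *)
(** The generator of the perturbed semigroup is quasi-dissipative. For
    [u = (x, f)] in the domain, the shift part contributes
    [<f', f> = (|x|^2 - |f(-1)|^2) / 2], and the loss [- |f(-1)|^2 / 2] absorbs the
    delay term [<A1 f(-1), x>], so that
    [<B u, u> <= w |u|^2] with [w = (1 + |A1|^2) / 2]. Hence
    [|TT t u| <= exp (w t) |u|] on the domain, and by density everywhere; this is
    stronger than the announced bound, since
    [exp (a^2 t / 2) <= 1 + a (sqrt 2 exp (2 a^2)) (sqrt t)] for [0 <= t <= 1].
    All vector-valued integrals are handled through their scalar products with a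
    fixed vector. *)

Require Import Defs.
From HB Require Import structures.
From mathcomp Require Import all_boot all_order all_algebra.
From mathcomp Require Import all_classical all_reals all_analysis.
From mathcomp Require Import finmap measurable_realfun ring lra.
Set Implicit Arguments.
Unset Strict Implicit.
Unset Printing Implicit Defensive.
Import Order.TTheory GRing.Theory Num.Theory.
Import numFieldNormedType.Exports.
Local Open Scope classical_set_scope.
Local Open Scope ring_scope.

(** * Hilbert spaces, bounded operators and semigroups *)

(** The delicate step is the energy identity for |f|^2: f is only weakly differentiable with values
    in X, so no pointwise product rule is at hand. Testing with plateaus gives the increments of the
    continuous representative F paired with one fixed vector. Since |F t|^2 - |F s|^2 = <F t - F s,
    F t + F s>, taking F t + F s as that vector gives the identity on short intervals up to an error
    controlled by the continuity of F, and real induction adds up the errors. Density of domains is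
    not part of [generates]. The averaging argument uses completeness and a scalar product and is
    applied to X. [L2 X] carries only its norm here, so density in the delay space is obtained
    directly: thin boundary layers separate the trace at 0 from the function, then smooth profiles,
    indicators and simple functions exhaust L2. The constant w comes from a |x| |f(-1)| <= (a^2
    |x|^2 + |f(-1)|^2) / 2 with a = |A1|, added to the |x|^2 / 2 of the shift. *)

Section Dot.
Context {R : realType} {X : normedModType R} (dot : {dot X for idfun}).
Hypothesis X_hilbert : norm_of_dot dot.
Implicit Types x y z : X.

Lemma dotC x y : dot x y = dot y x.
Proof. by rewrite hermC expr0 mul1r. Qed.

Lemma dotDl x y z : dot (x + y) z = dot x z + dot y z.
Proof. exact: linearDl. Qed.

Lemma dotDr x y z : dot x (y + z) = dot x y + dot x z.
Proof. by rewrite dotC dotDl !(dotC x). Qed.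

Lemma dotNl x y : dot (- x) y = - dot x y.
Proof. exact: linearNl. Qed.

Lemma dotNr x y : dot x (- y) = - dot x y.
Proof. by rewrite dotC dotNl dotC. Qed.

Lemma dotBl x y z : dot (x - y) z = dot x z - dot y z.
Proof. by rewrite dotDl dotNl. Qed.

Lemma dot0l y : dot 0 y = 0.
Proof. exact: linear0l. Qed.

Lemma dot0r x : dot x 0 = 0.
Proof. by rewrite dotC dot0l. Qed.

Lemma dot_sqrD x y : `|x + y| ^+ 2 = `|x| ^+ 2 + 2 * dot x y + `|y| ^+ 2.
Proof.
rewrite !X_hilbert dotDl !dotDr (dotC y x).
move: (dot x x) (dot x y) (dot y y) => a b c; ring.
Qed.

Lemma dotZl a x y : dot (a *: x) y = a * dot x y.
Proof. exact: linearZl_LR. Qed.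

Lemma dotZr a x y : dot x (a *: y) = a * dot x y.
Proof. by rewrite dotC dotZl dotC. Qed.

(** Reduces measurability of scalar products to that of norms of sums and differences. *)
Lemma dot_polarization x y :
  dot x y = 4^-1 * (`|x + y| ^+ 2 - `|x - y| ^+ 2).
Proof.
rewrite !dot_sqrD normrN dotNr.
by move: (dot x y) (`|x|) (`|y|) => a b c; field.
Qed.

Lemma dot_le x y : `|dot x y| <= `|x| * `|y|.
Proof.
have [->|y0] := eqVneq y 0.
  by rewrite dot0r !normr0 mulr0.
have ny : 0 < `|y| by rewrite normr_gt0.
(* This is |y|^2 times the component of x orthogonal to y; its squared norm is |y|^2 (|x|^2 |y|^2 -
   <x, y>^2). *)
have h : 0 <= `|(`|y| ^+ 2) *: x + (- dot x y) *: y| ^+ 2 by exact: sqr_ge0.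
move: h; rewrite dot_sqrD !normrZ dotZl dotZr normrN !exprMn.
rewrite (real_normK (num_real (dot x y))) !normr_id.
set d := dot x y; set a := `|x|; set b := `|y| => h.
have : 0 <= b ^+ 2 * (a ^+ 2 * b ^+ 2 - d ^+ 2).
  by apply: le_trans h _; rewrite le_eqVlt; apply/orP; left; apply/eqP; ring.
rewrite pmulr_rge0 ?exprn_gt0// subr_ge0 -exprMn -(real_normK (num_real d)).
by rewrite ler_pXn2r// nnegrE ?mulr_ge0 ?normr_ge0.
Qed.

Lemma dot_cvgl (T : Type) (F : set_system T) {FF : Filter F} (f : T -> X) x y :
  f @ F --> x -> dot (f t) y @[t --> F] --> dot x y.
Proof.
move=> fx; apply/cvgrPdist_le => e e0.
have e0' : 0 < e / (1 + `|y|) by rewrite divr_gt0// ltr_wpDr.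
move/cvgrPdist_le: fx => /(_ _ e0'); apply: filterS => t h.
rewrite -dotBl; apply: le_trans (dot_le _ _) _.
apply: le_trans (_ : e / (1 + `|y|) * (1 + `|y|) <= _); last first.
  by rewrite divfK// gt_eqF// ltr_wpDr.
by apply: ler_pM => //; rewrite lerDr.
Qed.

End Dot.

Section OperatorNorm.
Context {R : realType} {V W : normedModType R}.

Lemma continuous_linear_bound (F : {linear V -> W}) : continuous F ->
  exists M, forall x, `|x| <= 1 -> `|F x| <= M.
Proof. by move/linear_bounded_continuous/bounded_funP => /(_ 1). Qed.

(** [opnorm] is a real supremum, informative only for a set bounded above; continuity supplies that
    bound. *)
Lemma opnorm_bound (F : {linear V -> W}) x : continuous F ->
  `|F x| <= opnorm F * `|x|.
Proof.
move=> /continuous_linear_bound[M hM].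
have ubF : has_ubound [set `|F x| | x in [set x : V | `|x| <= 1]].
  by exists M => _ [z /= z1 <-]; exact: hM.
have [->|x0] := eqVneq x 0; first by rewrite linear0 !normr0 mulr0.
have nx : 0 < `|x| by rewrite normr_gt0.
rewrite -ler_pdivrMr// -(ger0_norm (ltW nx)) mulrC -normfV -normrZ -linearZ.
apply: ub_le_sup => //=; exists (`|x|^-1 *: x) => //=.
by rewrite normrZ normfV normr_id mulVf ?gt_eqF.
Qed.

Lemma opnorm_le (F : V -> W) C : 0 <= C -> (forall x, `|F x| <= C * `|x|) ->
  opnorm F <= C.
Proof.
move=> C0 FC; apply: ge_sup; first by exists `|F 0|, 0 => //=; rewrite normr0.
by move=> _ [x /= x1 <-]; apply: le_trans (FC x) _; exact: ler_piMr.
Qed.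

Lemma opnorm_ge0 (F : {linear V -> W}) : continuous F -> 0 <= opnorm F.
Proof.
move=> /continuous_linear_bound[M hM].
apply: ub_le_sup; first by exists M => _ [z /= z1 <-]; exact: hM.
by exists 0; rewrite /= ?linear0 ?normr0.
Qed.

End OperatorNorm.

Section RealInduction.
Context {R : realType}.

(* Right-openness replaces the step of induction, closedness on the left the
   limit case. *)
Lemma real_induction (P : R -> Prop) :
  P 0 ->
  (forall t, 0 <= t -> P t -> exists2 d, 0 < d & forall h, 0 <= h <= d -> P (t + h)) ->
  (forall t, 0 < t -> (forall s, 0 <= s < t -> P s) -> P t) ->
  forall t, 0 <= t -> P t.
Proof.
move=> P0 Pstep Plim t t0.
pose S := [set r | 0 <= r <= t /\ forall s, 0 <= s <= r -> P s].
have S0 : S 0.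
  by split; [rewrite lexx t0|move=> s /le_anti <-].
have ubS : has_ubound S by exists t => r [/andP[]].
have supS : has_sup S by split => //; exists 0.
pose b := sup S.
have b0 : 0 <= b by exact: ub_le_sup.
have bt : b <= t by apply: ge_sup => [|r [/andP[]]//]; exists 0.
have Plt s : 0 <= s < b -> P s.
  move=> /andP[s0 sb]; have bs : 0 < b - s by rewrite subr_gt0.
  have [r Sr sr] := sup_adherent bs supS.
  move: Sr => [_]; apply; rewrite s0/= ltW//.
  by apply: le_lt_trans sr; rewrite -/b opprB addrC subrK.
have Pb : P b.
  by move: b0; rewrite le_eqVlt => /predU1P[<-//|/Plim]; exact.
have [d d0 Pd] := Pstep b b0 Pb.
have [bt'|tb] := ltP b t; last by rewrite (_ : t = b)//; apply/eqP; rewrite eq_le tb bt.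
(* If the supremum [b] were below [t], the step at [b] would carry [P] on to [b + e]. *)
exfalso; pose e := Num.min d (t - b).
have e0 : 0 < e by rewrite /e lt_min d0 subr_gt0.
suff : b + e <= b by rewrite gerDl leNgt e0.
apply: ub_le_sup => //; split.
  by rewrite addr_ge0 ?(ltW e0)//= -lerBrDl /e ge_min lexx orbT.
move=> s /andP[s0 sbe]; have [sb|bs] := ltP s b; first by apply: Plt; rewrite s0.
rewrite (_ : s = b + (s - b)); last by rewrite addrC subrK.
apply: Pd; rewrite subr_ge0 bs/= lerBlDl (le_trans sbe)// lerD2l /e ge_min lexx.
by [].
Qed.

End RealInduction.

(** * Growth of a semigroup from a differential inequality at time 0 *)

Section Semigroup.
Context {R : realType} {V : normedModType R} (T : R -> {linear V -> V}).
Context (D : set V) (B : V -> V).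
Hypothesis T_semigroup : C0_semigroup T.
Hypothesis T_generator : generates T D B.

Lemma generator_invariant (t : R) u : 0 <= t -> D u -> D (T t u).
Proof.
move=> t0 Du; have /T_generator h : D u /\ B u = B u by split.
suff [] : D (T t u) /\ B (T t u) = T t (B u) by [].
apply/T_generator.
have cT := C0_bounded T_semigroup t0.
have h2 : T t (r^-1 *: (T r u - u)) @[r --> 0^'+] --> T t (B u).
  by apply: continuous_cvg => //; exact: cT.
apply: cvg_trans h2.
apply: near_eq_cvg; near=> h'; have h'0 : 0 <= h' by near: h'; exact: nbhs_right_ge.
rewrite /= linearZ linearB; congr (_ *: (_ - _)).
by rewrite -!(C0_add T_semigroup)// addrC.
Unshelve. all: by end_near. Qed.

(* A one-sided differential inequality for the squared norm at time 0 propagates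
   along the orbit by the semigroup property. *)
Lemma semigroup_growth (w : R) : 0 <= w ->
  (forall u (e : R), D u -> 0 < e -> \forall h \near 0^'+,
     `|T h u| ^+ 2 <= `|u| ^+ 2 * (1 + 2 * w * h) + e * h) ->
  forall u (t : R), D u -> 0 <= t -> `|T t u| <= expR (w * t) * `|u|.
Proof.
move=> w0 Tw u t Du t0.
(* The slack [e] enters twice: in the initial value it keeps [E] positive even when u = 0, in the
   rate it pays for the error term of [Tw]. It is sent to 0 afterwards. *)
have psi (e s : R) : 0 < e -> 0 <= s ->
    `|T s u| ^+ 2 <= (`|u| ^+ 2 + e) * expR ((2 * w + e) * s).
  move=> e0; pose E s := (`|u| ^+ 2 + e) * expR ((2 * w + e) * s).
  rewrite -/(E s); move: s.
  have E0 s : 0 < E s by rewrite mulr_gt0 ?expR_gt0// ltr_wpDl// sqr_ge0.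
  apply: real_induction.
  - by rewrite (C0_id T_semigroup) /E mulr0 expR0 mulr1 lerDl ltW.
  - move=> s s0 Es.
    (* An error proportional to [E s] turns the factor 1 + 2 w h into 1 + (2 w + e) h, which is at
       most the exponential. *)
    have := Tw (T s u) (e * E s) (generator_invariant s0 Du) (mulr_gt0 e0 (E0 s)).
    case => d /= d0 hd; exists (d / 2); first by rewrite divr_gt0.
    move=> h /andP[]; rewrite le_eqVlt => /predU1P[<- _|h0 hd2].
      by rewrite addr0.
    have h0' := ltW h0.
    have := hd h; rewrite /ball/= sub0r normrN gtr0_norm// => /(_ _ h0).
    have hlt : h < d by apply: le_lt_trans hd2 _; rewrite ltr_pdivrMr// ltr_pMr// ltr1n.
    move=> /(_ hlt).
    rewrite -(C0_add T_semigroup)// (addrC h s) => /le_trans; apply.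
    apply: le_trans (_ : E s * (1 + (2 * w + e) * h) <= _).
      rewrite (_ : E s * _ = E s * (1 + 2 * w * h) + e * E s * h); last by ring.
      by rewrite lerD2r ler_wpM2r// addr_ge0// mulr_ge0// mulr_ge0.
    have -> : E (s + h) = E s * expR ((2 * w + e) * h).
      by rewrite /E mulrDr expRD mulrA.
    by rewrite ler_wpM2l ?expR_ge1Dx// ltW.
  - move=> s s0 Es.
    have cT : T r u @[r --> s^'-] --> T s u.
      apply: cvg_at_left_filter.
      have /subspace_continuousP/(_ s (ltW s0)) := @C0_continuous _ _ _ T_semigroup u.
      move=> h; apply/cvgrPdist_le => e1 e10; move/cvgrPdist_le: h => /(_ e1 e10).
      rewrite near_withinE => h1; apply: filterS2 h1 (lt_nbhsr s0) => r h1 r0.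
      by apply: h1; exact: ltW.
    have cE : E r @[r --> s^'-] --> E s.
      apply: cvg_at_left_filter; apply: cvgMl_tmp.
      apply: continuous_cvg; first exact: continuous_expR.
      by apply: cvgMl_tmp; exact: cvg_id.
    have cT2 : `|T r u| ^+ 2 @[r --> s^'-] --> `|T s u| ^+ 2.
      by rewrite expr2; apply: cvgM; exact: cvg_norm.
    apply: ler_cvg_to cT2 cE _; near=> r; apply: Es; apply/andP; split.
      by apply/ltW; near: r; exact: nbhs_left_gt.
    by near: r; exact: nbhs_left_lt.
have psi0 : `|T t u| ^+ 2 <= `|u| ^+ 2 * expR (2 * w * t).
  have cE : (`|u| ^+ 2 + e) * expR ((2 * w + e) * t) @[e --> 0^'+] -->
      (`|u| ^+ 2 + 0) * expR ((2 * w + 0) * t).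
    apply: cvg_at_right_filter; apply: cvgM.
      by apply: cvgD; [exact: cvg_cst|exact: cvg_id].
    apply: continuous_cvg; first exact: continuous_expR.
    by apply: cvgMr_tmp; apply: cvgD; [exact: cvg_cst|exact: cvg_id].
  have := ler_cvg_to (cvg_cst (`|T t u| ^+ 2)) cE; rewrite !addr0; apply.
  by near=> e; apply: psi.
rewrite -(@ler_pXn2r _ 2%N)// ?nnegrE ?mulr_ge0 ?expR_ge0//.
rewrite exprMn mulrC (_ : expR _ ^+ 2 = expR (2 * w * t))//.
by rewrite expr2 -expRD; congr expR; ring.
Unshelve. all: by end_near. Qed.

End Semigroup.

(** * Integrals of real functions *)

Section RealIntegration.
Context {d : measure_display} {T : measurableType d} {R : realType}.
Variables (mu : {measure set T -> \bar R}) (D : set T).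
Hypothesis mD : measurable D.
Implicit Types f g : T -> R.

Lemma integrable_sub f g : mu.-integrable D (EFin \o f) ->
  mu.-integrable D (EFin \o g) -> mu.-integrable D (EFin \o (fun t => f t - g t)).
Proof. by move=> i_f ig; apply: eq_integrable (integrableB mD i_f ig). Qed.

Lemma integrable_add f g : mu.-integrable D (EFin \o f) ->
  mu.-integrable D (EFin \o g) -> mu.-integrable D (EFin \o (fun t => f t + g t)).
Proof. by move=> i_f ig; apply: eq_integrable (integrableD mD i_f ig). Qed.

Lemma integrable_mull (c : R) f : mu.-integrable D (EFin \o f) ->
  mu.-integrable D (EFin \o (fun t => c * f t)).
Proof. by move=> i_f; apply: eq_integrable (integrableZl mD c i_f). Qed.

Lemma integrable_mulr (c : R) f : mu.-integrable D (EFin \o f) ->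
  mu.-integrable D (EFin \o (fun t => f t * c)).
Proof. by move=> i_f; apply: eq_integrable (integrableZr mD c i_f). Qed.

Lemma integrable_dominated f g : measurable_fun D f ->
  mu.-integrable D (EFin \o g) -> (forall t, D t -> `|f t| <= g t) ->
  mu.-integrable D (EFin \o f).
Proof.
move=> mf ig fg; apply: le_integrable ig => //; first exact/measurable_EFinP.
move=> t Dt /=; rewrite lee_fin (le_trans (fg t Dt))//.
by rewrite ger0_norm// (le_trans _ (fg t Dt)).
Qed.

Lemma integrable_bounded f M : (mu D < +oo)%E -> measurable_fun D f ->
  (forall t, D t -> `|f t| <= M) -> mu.-integrable D (EFin \o f).
Proof.
move=> muD mf fM; apply: measurable_bounded_integrable => //.
by exists M; split; [exact: num_real|move=> x Mx t Dt; exact: le_trans (fM t Dt) (ltW Mx)].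
Qed.

Lemma Rdominated_convergence (f_ : nat -> T -> R) f g :
  (forall n, measurable_fun D (f_ n)) ->
  (forall t, D t -> f_ n t @[n --> \oo] --> f t) ->
  mu.-integrable D (EFin \o g) ->
  (forall n t, D t -> `|f_ n t| <= g t) ->
  mu.-integrable D (EFin \o f) /\
  \int[mu]_(t in D) f_ n t @[n --> \oo] --> \int[mu]_(t in D) f t.
Proof.
move=> mf_ cf ig fg.
have mf : measurable_fun D f by apply: measurable_fun_cvg cf.
have [] := @dominated_convergence _ _ _ mu D mD (fun n => EFin \o f_ n)
  (EFin \o f) (EFin \o g).
- by move=> n; exact/measurable_EFinP.
- exact/measurable_EFinP.
- by apply: aeW => t Dt; apply: cvg_EFin; [exact: nearW|exact: cf].
- by [].
- by apply: aeW => t n Dt; rewrite /= lee_fin; exact: fg.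
move=> i_f _ ci; split => //.
by apply/fine_cvg; rewrite fineK; [exact: ci|exact: integrable_fin_num].
Qed.

Lemma Rintegral_sum (I : Type) (s : seq I) (h : I -> T -> R) :
  (forall i, mu.-integrable D (EFin \o h i)) ->
  mu.-integrable D (EFin \o (fun t => \sum_(i <- s) h i t)) /\
  \int[mu]_(t in D) (\sum_(i <- s) h i t) = \sum_(i <- s) \int[mu]_(t in D) h i t.
Proof.
move=> ih; elim: s => [|i s [IHi IH]].
  rewrite big_nil; split.
    by apply: eq_integrable (integrable0 mu D) => // t _; rewrite /= big_nil.
  under eq_Rintegral do rewrite big_nil.
  by rewrite Rintegral_cst// mul0r.
have E : (fun t => \sum_(j <- i :: s) h j t) =
    (fun t => h i t + \sum_(j <- s) h j t).
  by apply/funext => t; rewrite big_cons.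
split; last by rewrite big_cons -IH -RintegralD// -E.
by rewrite E; exact: integrable_add.
Qed.

Lemma Rintegral_indicM (A : set T) (c : R) : measurable A -> (mu D < +oo)%E ->
  mu.-integrable D (EFin \o (fun t => \1_A t * c)) /\
  \int[mu]_(t in D) (\1_A t * c) = fine (mu (D `&` A)) * c.
Proof.
move=> mA muD.
have iA : mu.-integrable D (EFin \o (\1_A : T -> R)).
  apply: (integrable_bounded (M := 1)) => // t _.
  by rewrite indicE; case: (t \in A); rewrite ?normr1 ?normr0.
split; last by rewrite RintegralZr// /Rintegral integral_indic// setIC.
exact: integrable_mulr.
Qed.

End RealIntegration.

(** * Bochner integration *)

Section SimpleFunctions.
Import HBSimple.
Context {d : measure_display} {T : measurableType d} {R : realType}.
Context {X : normedModType R}.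
Implicit Types (s f : T -> X) (D : set T).

(** Unlike in [is_simple_comp2], the arguments may take values outside X: scalars, or the truth
    value of a membership. *)
Lemma is_simple_comp (Y Z : Type) (g : Y -> Z -> X) (s1 : T -> Y) (s2 : T -> Z) :
  finite_set (range s1) -> (forall y, measurable (s1 @^-1` [set y])) ->
  finite_set (range s2) -> (forall z, measurable (s2 @^-1` [set z])) ->
  is_simple (fun t => g (s1 t) (s2 t)).
Proof.
move=> f1 m1 f2 m2; split.
  apply: (@sub_finite_set _ _ ((fun p => g p.1 p.2) @` (range s1 `*` range s2))).
    by move=> _ [t _ <-]; exists (s1 t, s2 t) => //=; split; exists t.
  by apply: finite_image; exact: finite_setX.
move=> x; rewrite (_ : _ @^-1` _ =
  \bigcup_(p in (range s1 `*` range s2) `&` [set p | g p.1 p.2 = x])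
    (s1 @^-1` [set p.1] `&` s2 @^-1` [set p.2])).
  apply: fin_bigcup_measurable; first by apply: finite_setIl; exact: finite_setX.
  by move=> p _; exact: measurableI.
apply/seteqP; split=> [t /= gx|t [p [_ /= <-] [-> ->]]//].
by exists (s1 t, s2 t) => //=; split => //; split; exists t.
Qed.

(** Simple approximations of the real function [q] are pushed through the continuous [F]. With [q]
    the identity this covers continuous functions on an interval. *)
Lemma strongly_measurable_comp D (F : R -> X) (q : T -> R) : measurable D ->
  measurable_fun D q -> continuous F -> strongly_measurable D (F \o q).
Proof.
move=> mD /measurable_EFinP mq cF; have [g cg] := approximation_sfun mD mq.
exists (fun n => F \o g n).
  by move=> n; apply: (is_simple_comp (fun y (_ : R) => F y) (s1 := g n) (s2 := g n)).
move=> t Dt; apply: continuous_cvg; first exact: cF.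
by have /fine_cvg := cg t Dt.
Qed.

Lemma strongly_measurable_scale D (phi : T -> R) f : measurable D ->
  measurable_fun D phi -> strongly_measurable D f ->
  strongly_measurable D (fun t => phi t *: f t).
Proof.
move=> mD /measurable_EFinP mq [s_ ss cs].
have [g cg] := approximation_sfun mD mq.
exists (fun n t => g n t *: s_ n t).
  move=> n; have [fs ms] := ss n.
  apply: (is_simple_comp (fun (a : R) (x : X) => a *: x)) => //.
move=> t Dt; apply: cvgZ; last exact: cs.
by have /fine_cvg := cg t Dt.
Qed.

Lemma is_simple_restrict (A : set T) s : measurable A -> is_simple s ->
  is_simple (fun t => if t \in A then s t else 0).
Proof.
move=> mA [fs ms].
apply: (is_simple_comp (fun (b : bool) x => if b then x else 0)
  (s1 := fun t => t \in A)) => //.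
move=> b; have -> : (fun t => t \in A) @^-1` [set b] = if b then A else ~` A.
  apply/seteqP; split => t /=; first by move=> <-; have [tA|tA] := pselect (A t); rewrite ?(mem_set tA) ?(memNset tA).
  by case: b => /= h; [exact: mem_set|exact: memNset].
by case: b => //; exact: measurableC.
Qed.

(* Truncating where [|s_n| <= 2 |f|] makes the approximation dominated. *)
Lemma strongly_measurable_dominated D f : measurable D ->
  strongly_measurable D f -> exists s_ : nat -> T -> X,
    [/\ forall n, is_simple (s_ n),
        forall t, D t -> s_ n t @[n --> \oo] --> f t &
        forall n t, D t -> `|s_ n t| <= 2 * `|f t|].
Proof.
move=> mD smf; have mf := strongly_measurable_norm mD smf.
have [s_ ss cs] := smf.
pose A n := D `&` [set t | `|s_ n t| <= 2 * `|f t|].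
have mA n : measurable (A n).
  apply: measurable_fun_le => //; last exact: measurable_funM.
  by apply: measurable_funTS; exact: measurable_norm_simple.
exists (fun n t => if t \in A n then s_ n t else 0); split.
- by move=> n; exact: is_simple_restrict.
- move=> t Dt; have [ft0|ft0] := eqVneq (f t) 0.
    rewrite ft0; apply: cvg_near_cst; apply: nearW => n.
    case: ifPn => // /set_mem[_] /=; rewrite ft0 normr0 mulr0.
    by rewrite normr_le0 => /eqP.
  apply: cvg_trans (cs t Dt); apply: near_eq_cvg.
  (* Once |f t - s_n t| < |f t|, the bound |s_n t| <= 2 |f t| holds and the truncation no longer
     acts. *)
  have nf : 0 < `|f t| by rewrite normr_gt0.
  have /cvgrPdist_lt/(_ _ nf) := cs t Dt.
  apply: filterS => n /= h; case: ifPn => // /negP; case; apply: mem_set.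
  split => //=; rewrite mulr_natl mulr2n -lerBlDr.
  by apply: le_trans (lerB_dist _ _) _; rewrite distrC ltW.
- move=> n t Dt; case: ifPn => [/set_mem[]//|_].
  by rewrite normr0 mulr_ge0.
Qed.

End SimpleFunctions.

(** * Bounded functionals commute with the Bochner integral *)

Section Functionals.
Context {d : measure_display} {T : measurableType d} {R : realType}.
Context {X : normedModType R}.
Variables (mu : {measure set T -> \bar R}) (D : set T).
Hypothesis mD : measurable D.
Implicit Types (s f g : T -> X).

Lemma is_simple_strongly_measurable s : is_simple s -> strongly_measurable D s.
Proof. by move=> ss; exists (fun=> s) => // t _; exact: cvg_cst. Qed.

Lemma strongly_measurable_sub f g :
  strongly_measurable D f -> strongly_measurable D g ->
  strongly_measurable D (fun t => f t - g t).
Proof.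
apply: (strongly_measurable_comp2 (g := fun x y => x - y)) => p.
by apply: cvgB; [exact: cvg_fst|exact: cvg_snd].
Qed.

Lemma strongly_measurable_add f g :
  strongly_measurable D f -> strongly_measurable D g ->
  strongly_measurable D (fun t => f t + g t).
Proof.
apply: (strongly_measurable_comp2 (g := fun x y => x + y)) => p.
by apply: cvgD; [exact: cvg_fst|exact: cvg_snd].
Qed.

Lemma is_simple_bounded s : is_simple s -> exists M, forall t, `|s t| <= M.
Proof.
move=> [fs _]; have /finite_seqP[r rE] : finite_set [set `|x| | x in range s].
  exact: finite_image.
exists (\sum_(x <- r) `|x|) => t.
have : `|s t| \in r.
  by have : [set` r] `|s t| by rewrite -rE; exists (s t) => //; exists t.
elim: r {rE} => // a r IH; rewrite inE big_cons => /predU1P[->|/IH h].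
  by rewrite ler_wpDr ?sumr_ge0 ?ler_norm.
by rewrite (le_trans h)// lerDr.
Qed.

Hypothesis muD : (mu D < +oo)%E.

Lemma integrable_norm_simple s : is_simple s ->
  mu.-integrable D (EFin \o (fun t => `|s t|)).
Proof.
move=> ss; have [M sM] := is_simple_bounded ss.
apply: (integrable_bounded mD (M := M)) => //; last by move=> t _; rewrite normr_id.
by apply: strongly_measurable_norm => //; exact: is_simple_strongly_measurable.
Qed.

Variables (l : X -> R) (C : R).
Hypothesis lD : {morph l : x y / x + y}.
Hypothesis lZ : forall a x, l (a *: x) = a * l x.

Let l0 : l 0 = 0.
Proof. by rewrite -(scale0r 0) lZ mul0r. Qed.

Let lB : {morph l : x y / x - y}.
Proof. by move=> x y; rewrite -scaleN1r lD lZ mulN1r. Qed.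

Let simple_functionalE s : is_simple s -> (fun t => l (s t)) =
  (fun t => \sum_(x <- fset_set (range s)) \1_(s @^-1` [set x]) t * l x).
Proof.
move=> [fs ms]; apply/funext => t.
have st : s t \in fset_set (range s) by rewrite in_fset_set//; apply: mem_set; exists t.
rewrite (bigD1_seq (s t))//= ?fset_uniq//.
rewrite big1 ?addr0; last first.
  move=> x xs; rewrite indicE memNset ?mul0r// => /= sx.
  by rewrite sx eqxx in xs.
by rewrite indicE mem_set// mul1r.
Qed.

Lemma functional_simple_integral s : is_simple s ->
  l (simple_integral mu D s) = \int[mu]_(t in D) l (s t).
Proof.
move=> ss; have [fs ms] := ss; rewrite /simple_integral fsbig_finite//=.
have lsum (I : Type) (r : seq I) (F : I -> X) :
    l (\sum_(i <- r) F i) = \sum_(i <- r) l (F i).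
  by elim/big_ind2 : _ => [|u a v b <- <-|]//; exact: l0.
rewrite lsum (simple_functionalE ss).
have [_ ->] := @Rintegral_sum _ _ _ mu D mD _ (fset_set (range s))
  (fun x t => \1_(s @^-1` [set x]) t * l x)
  (fun x => (Rintegral_indicM mD (l x) (ms x) muD).1).
apply: eq_bigr => x _; rewrite lZ.
by have [_ ->] := Rintegral_indicM mD (l x) (ms x) muD.
Qed.

Hypothesis C0 : 0 <= C.
Hypothesis lC : forall x, `|l x| <= C * `|x|.

Lemma functional_cvg (I : Type) (F : set_system I) {FF : Filter F} (f : I -> X) x :
  f @ F --> x -> l (f t) @[t --> F] --> l x.
Proof.
move=> fx; apply/cvgrPdist_le => e e0.
(* Dividing by 1 + C instead of C covers the case C = 0. *)
have C1 : 0 < 1 + C by rewrite ltr_wpDr.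
have e0' : 0 < e / (1 + C) by rewrite divr_gt0.
move/cvgrPdist_le: fx => /(_ _ e0'); apply: filterS => t h.
rewrite -lB; apply: le_trans (lC _) _.
apply: le_trans (_ : (1 + C) * (e / (1 + C)) <= _); last first.
  by rewrite mulrC divfK// gt_eqF.
by apply: ler_pM => //; rewrite lerDr.
Qed.

Lemma measurable_functional f : strongly_measurable D f ->
  measurable_fun D (fun t => l (f t)).
Proof.
move=> [s_ ss cs]; apply: (measurable_fun_cvg (h := fun n t => l (s_ n t))) => //.
  move=> n; rewrite (simple_functionalE (ss n)); apply: measurable_sum => x.
  by apply: measurable_funM => //; apply: measurable_indic; exact: (ss n).2.
by move=> t Dt; apply: functional_cvg; exact: cs.
Qed.

Lemma integrable_functional f : strongly_measurable D f ->
  mu.-integrable D (EFin \o (fun t => `|f t|)) ->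
  mu.-integrable D (EFin \o (fun t => l (f t))).
Proof.
move=> mf i_f.
have i_fC : mu.-integrable D (EFin \o (fun t => C * `|f t|)).
  exact: (integrable_mull mD C i_f).
by apply: integrable_dominated i_fC _ => //; exact: measurable_functional.
Qed.

(** Both sides are limits of [l] applied to the simple integrals: the left one by continuity of [l],
    the right one because the integral of |l f - l s_n| is at most C times that of |f - s_n|. *)
Lemma is_bochner_functional f v : strongly_measurable D f ->
  mu.-integrable D (EFin \o (fun t => `|f t|)) ->
  is_bochner mu D f v -> l v = \int[mu]_(t in D) l (f t).
Proof.
move=> mf i_f [s_ [ss cs c0 cv]].
have c1 : l (simple_integral mu D (s_ n)) @[n --> \oo] --> l v.
  exact: functional_cvg.
suff c2 : l (simple_integral mu D (s_ n)) @[n --> \oo] -->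
  \int[mu]_(t in D) l (f t) by exact: (cvg_unique _ c1 c2).
have sm n := is_simple_strongly_measurable (ss n).
have is_ n := integrable_norm_simple (ss n).
have mfs n := strongly_measurable_norm mD (strongly_measurable_sub mf (sm n)).
have il n : mu.-integrable D (EFin \o (fun t => l (f t) - l (s_ n t))).
  exact: (integrable_sub mD (integrable_functional mf i_f)
    (integrable_functional (sm n) (is_ n))).
have ifs n : mu.-integrable D (EFin \o (fun t => `|f t - s_ n t|)).
  apply: (integrable_dominated mD (g := fun t => `|f t| + `|s_ n t|)) => //.
    exact: (integrable_add mD i_f (is_ n)).
  by move=> t _; rewrite normr_id ler_normB.
have {c0} c0 : \int[mu]_(t in D) `|f t - s_ n t| @[n --> \oo] --> (0 : R).
  by have /fine_cvg := c0.
apply/cvgrPdist_le => e e0.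
have C1 : 0 < 1 + C by rewrite ltr_wpDr.
have e0' : 0 < e / (1 + C) by rewrite divr_gt0.
move/cvgrPdist_le: c0 => /(_ _ e0'); apply: filterS => n.
rewrite sub0r normrN ger0_norm ?Rintegral_ge0// => h.
rewrite functional_simple_integral// -RintegralB//; [|exact: integrable_functional..].
apply: le_trans (le_normr_Rintegral _ (il n)) _ => //.
apply: (@le_trans _ _ (C * \int[mu]_(t in D) `|f t - s_ n t|)).
  rewrite -RintegralZl//; apply: le_Rintegral => //.
  - exact: (integrable_norm (il n)).
  - exact: (integrable_mull mD C (ifs n)).
  - by move=> t _; rewrite -lB; exact: lC.
apply: le_trans (_ : (1 + C) * (e / (1 + C)) <= _); last first.
  by rewrite mulrC divfK// gt_eqF.
by apply: ler_pM => //; rewrite ?Rintegral_ge0// lerDr.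
Qed.

End Functionals.

Section Bochner.
Context {d : measure_display} {T : measurableType d} {R : realType}.
Context {X : normedModType R} (dot : {dot X for idfun}).
Hypothesis X_hilbert : norm_of_dot dot.
Variables (mu : {measure set T -> \bar R}) (D : set T).
Hypothesis mD : measurable D.
Implicit Types (s f g : T -> X).

Lemma strongly_measurable_cst (x : X) : strongly_measurable D (fun=> x : X).
Proof.
apply: is_simple_strongly_measurable.
by apply: (is_simple_comp (fun (_ : unit) (_ : unit) => x)
  (s1 := fun=> tt) (s2 := fun=> tt)) => // -[];
  rewrite (_ : _ @^-1` _ = setT)//; apply/seteqP.
Qed.

Lemma measurable_dot f g :
  strongly_measurable D f -> strongly_measurable D g ->
  measurable_fun D (fun t => dot (f t) (g t)).
Proof.
move=> mf mg; under eq_fun do rewrite (dot_polarization X_hilbert).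
apply: measurable_funM => //; apply: measurable_funB; apply: measurable_funX.
  by apply: strongly_measurable_norm => //; exact: strongly_measurable_add.
by apply: strongly_measurable_norm => //; exact: strongly_measurable_sub.
Qed.

Hypothesis muD : (mu D < +oo)%E.

Lemma integrable_dot f y : strongly_measurable D f ->
  mu.-integrable D (EFin \o (fun t => `|f t|)) ->
  mu.-integrable D (EFin \o (fun t => dot (f t) y)).
Proof.
move=> mf i_f.
apply: (integrable_functional mD (l := fun x => dot x y) (C := `|y|)) => //.
- by move=> u v; exact: dotDl.
- by move=> a u; exact: dotZl.
- by move=> u; rewrite mulrC; exact: dot_le.
Qed.

Lemma dot_simple_integral s y : is_simple s ->
  dot (simple_integral mu D s) y = \int[mu]_(t in D) dot (s t) y.
Proof.
move=> ss; apply: (functional_simple_integral mD muD (l := fun x => dot x y)) => //.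
- by move=> u v; exact: dotDl.
- by move=> a u; exact: dotZl.
Qed.

(** The difference [v] is paired with itself, |v|^2 being the integral of <s1 - s2, v>, and one
    factor |v| cancels. No common refinement of the two partitions is needed. *)
Lemma norm_simple_integralB s1 s2 : is_simple s1 -> is_simple s2 ->
  `|simple_integral mu D s1 - simple_integral mu D s2| <=
  \int[mu]_(t in D) `|s1 t - s2 t|.
Proof.
move=> ss1 ss2; set v := _ - _.
have [->|v0] := eqVneq v 0; first by rewrite normr0; exact: Rintegral_ge0.
have nv : 0 < `|v| by rewrite normr_gt0.
have sm1 := is_simple_strongly_measurable D ss1.
have sm2 := is_simple_strongly_measurable D ss2.
have i1 := integrable_norm_simple mD muD ss1; have i2 := integrable_norm_simple mD muD ss2.
have ss : is_simple (fun t => s1 t - s2 t) by exact: (is_simple_comp2 (fun x y => x - y)).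
have i12 := integrable_norm_simple mD muD ss.
rewrite -(ler_pM2r nv) -expr2 X_hilbert {1}/v dotBl !dot_simple_integral//.
rewrite -RintegralB//; [|exact: integrable_dot..].
rewrite -RintegralZr//; apply: le_Rintegral => //.
- exact: (integrable_sub mD (integrable_dot v sm1 i1)
    (integrable_dot v sm2 i2)).
- exact: (integrable_mulr mD `|v| i12).
by move=> t _; rewrite -dotBl; apply: le_trans (dot_le X_hilbert _ _); exact: ler_norm.
Qed.

Lemma is_bochner_dot f v y : strongly_measurable D f ->
  mu.-integrable D (EFin \o (fun t => `|f t|)) ->
  is_bochner mu D f v -> dot v y = \int[mu]_(t in D) dot (f t) y.
Proof.
apply: (is_bochner_functional mD muD (l := fun x => dot x y) (C := `|y|)) => //.
- by move=> u w; exact: dotDl.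
- by move=> a u; exact: dotZl.
- by move=> u; rewrite mulrC; exact: dot_le.
Qed.

End Bochner.

Section BochnerExistence.
Context {d : measure_display} {T : measurableType d} {R : realType}.
Context {X : completeNormedModType R} (dot : {dot X for idfun}).
Hypothesis X_hilbert : norm_of_dot dot.
Variables (mu : {measure set T -> \bar R}) (D : set T).
Hypotheses (mD : measurable D) (muD : (mu D < +oo)%E).

(** For a dominated simple approximation, |f - s_n| tends to 0 in L1, so the simple integrals are
    Cauchy and completeness of X provides the value. *)
Lemma is_bochner_exists (f : T -> X) : strongly_measurable D f ->
  mu.-integrable D (EFin \o (fun t => `|f t|)) -> exists v, is_bochner mu D f v.
Proof.
move=> mf i_f; have [s_ [ss cs bs]] := strongly_measurable_dominated mD mf.
have sm n := is_simple_strongly_measurable D (ss n).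
have mfs n := strongly_measurable_norm mD (strongly_measurable_sub mf (sm n)).
(* The factor 3 is 1 + 2, from |s_n| <= 2 |f|. *)
have bfs n t : D t -> `|f t - s_ n t| <= 3 * `|f t|.
  move=> Dt; apply: le_trans (ler_normB _ _) _.
  by have := bs n t Dt; lra.
have i3 : mu.-integrable D (EFin \o (fun t => 3 * `|f t|)).
  exact: (integrable_mull mD 3 i_f).
have [ _ c0] : mu.-integrable D (EFin \o (fun=> 0 : R)) /\
    \int[mu]_(t in D) `|f t - s_ n t| @[n --> \oo] --> \int[mu]_(t in D) (0 : R).
  apply: (Rdominated_convergence mD mfs (g := fun t => 3 * `|f t|)) => //.
    move=> t Dt; rewrite -(normr0 X) -(subrr (f t)); apply: cvg_norm.
    by apply: cvgB; [exact: cvg_cst|exact: cs].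
  by move=> n t Dt; rewrite normr_id; exact: bfs.
rewrite Rintegral_cst// mul0r in c0.
have ifs n : mu.-integrable D (EFin \o (fun t => `|f t - s_ n t|)).
  by apply: integrable_dominated i3 _ => // t Dt; rewrite normr_id; exact: bfs.
have cau : cauchy (simple_integral mu D (s_ n) @[n --> \oo]).
  apply/cauchy_exP => e e0.
  have e20 : 0 < e / 2 by rewrite divr_gt0.
  move/cvgrPdist_lt: c0 => /(_ _ e20)[n _ h].
  exists (simple_integral mu D (s_ n)); exists n => // m /= nm.
  have hn := h n (leqnn n); have hm := h m nm; rewrite /= in hn hm.
  rewrite -ball_normE/=; apply: le_lt_trans (norm_simple_integralB X_hilbert mD muD _ _) _ => //.
  rewrite sub0r normrN ger0_norm ?Rintegral_ge0// in hn.
  rewrite sub0r normrN ger0_norm ?Rintegral_ge0// in hm.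
  apply: le_lt_trans (_ : _ <= \int[mu]_(t in D) `|f t - s_ n t| +
    \int[mu]_(t in D) `|f t - s_ m t|) _; last by lra.
  rewrite -RintegralD//; apply: le_Rintegral => //.
  - by apply: (integrable_norm_simple mD muD); apply: (is_simple_comp2 (fun x y => x - y)).
  - exact: (integrable_add mD (ifs n) (ifs m)).
  - move=> t _; rewrite (distrC (f t) (s_ n t)).
    by apply: le_trans (ler_normD _ _); rewrite addrA subrK.
have /cvg_ex[v cv] : cvg (simple_integral mu D (s_ n) @[n --> \oo]).
  exact: cauchy_cvg.
exists v, s_; split => //.
have E n : (\int[mu]_(t in D) (`|f t - s_ n t|)%:E)%E =
    (\int[mu]_(t in D) `|f t - s_ n t|)%:E.
  by rewrite fineK// integrable_fin_num// ifs.
under eq_fun do rewrite E.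
by apply: cvg_EFin => //; exact: nearW.
Qed.

End BochnerExistence.

(** * Density of the domain of a generator *)

Section Calculus.
Context {R : realType}.
Local Notation mu := (@lebesgue_measure R).

Lemma Rintegral_is_derive (F f : R -> R) (a b : R) : a <= b ->
  {within `[a, b], continuous f} ->
  (forall x : R, a <= x <= b -> is_derive x 1 F (f x)) ->
  \int[mu]_(x in `[a, b]) f x = F b - F a.
Proof.
rewrite le_eqVlt => /predU1P[<- _ _|ab cf dF].
  by rewrite set_itv1 Rintegral_set1 subrr.
have cF x : a <= x <= b -> {for x, continuous F}.
  move=> axb; apply/differentiable_continuous/derivable1_diffP.
  by have [] := dF x axb.
have oo_cc x : x \in `]a, b[ -> a <= x <= b.
  by rewrite in_itv/= => /andP[ax xb]; rewrite !ltW.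
rewrite /Rintegral (@continuous_FTC2 _ f F)//.
- split; first by move=> x /oo_cc axb; have [] := dF x axb.
  + by apply: cvg_at_right_filter; apply: cF; rewrite lexx ltW.
  + by apply: cvg_at_left_filter; apply: cF; rewrite lexx andbT ltW.
- by move=> x /oo_cc axb; rewrite derive1E; have [_ ->] := dF x axb.
Qed.

Lemma continuous_primitive (q : R -> R) (a : R) : continuous q ->
  exists Q : R -> R, forall t : R, a <= t -> is_derive t 1 Q (q t).
Proof.
(* Starting at a - 1 makes [a] an interior point, so the derivative there is two-sided. *)
move=> cq; exists (fun t => \int[mu]_(s in `[a - 1, t]) q s) => t ta.
have at1 : a - 1 < t by rewrite (lt_le_trans _ ta)// ltrBlDr ltrDl.
have ttS : t < t + 1 by rewrite ltrDl.
have iq : mu.-integrable `[a - 1, t + 1] (EFin \o q).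
  apply: continuous_compact_integrable; first exact: segment_compact.
  exact: continuous_subspaceT.
have [d1 d2] := continuous_FTC1_closed ttS iq at1 (cq t).
by apply: DeriveDef; [exact: d1|rewrite -derive1E; exact: d2].
Qed.

(** With [Q] a primitive of [q], the left-hand side is the increment over [0, r] of K s = Q (h + s)
    - Q s - s (q h - q 0), whose derivative the hypothesis bounds by [e]; the mean value theorem
    concludes. It serves to differentiate the integral of an orbit over [0, h]. *)
Lemma integral_shift_le (q : R -> R) (h r e : R) : continuous q -> 0 <= h ->
  0 <= r -> (forall s : R, 0 <= s <= r -> `|q (h + s) - q h - (q s - q 0)| <= e) ->
  `|\int[mu]_(s in `[0, h]) q (s + r) - \int[mu]_(s in `[0, h]) q s
    - r * (q h - q 0)| <= e * r.
Proof.
move=> cq h0 r0 qe.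
have [Q dQ] := continuous_primitive 0 cq.
have dQ' (u s : R) : 0 <= u -> 0 <= s -> is_derive s 1 (fun s => Q (u + s)) (q (u + s)).
  move=> u0 s0; have dQus := dQ (u + s) (addr_ge0 u0 s0).
  rewrite -[q (u + s)]mulr1; apply: (@is_derive1_comp _ Q (fun s => u + s)) => //.
  by apply: is_derive_eq (is_deriveD (is_derive_cst u s 1) (is_derive_id s 1)) _; rewrite add0r.
have -> : \int[mu]_(s in `[0, h]) q s = Q h - Q 0.
  apply: Rintegral_is_derive => //; first exact: continuous_subspaceT.
  by move=> x /andP[x0 _]; exact: dQ.
have -> : \int[mu]_(s in `[0, h]) q (s + r) = Q (r + h) - Q r.
  under eq_Rintegral do rewrite addrC.
  rewrite -[in Q r](addr0 r).
  apply: (@Rintegral_is_derive (fun s => Q (r + s)) (fun s => q (r + s))) => //.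
    apply: continuous_subspaceT => x; apply: continuous_comp; last exact: cq.
    by apply: cvgD; [exact: cvg_cst|exact: cvg_id].
  by move=> x /andP[x0 _]; exact: dQ'.
move: r0 qe; rewrite le_eqVlt => /predU1P[<- _|r0 qe].
  by rewrite mul0r mulr0 add0r subrr subr0 normr0.
pose K s := Q (h + s) - Q s - s * (q h - q 0).
have dK (s : R) : 0 <= s -> is_derive s 1 K (q (h + s) - q s - (q h - q 0)).
  move=> s0; apply: is_deriveB; first by apply: is_deriveB; [exact: dQ'|exact: dQ].
  have := @is_deriveM _ _ id (cst (q h - q 0)) s 1 _ _ (is_derive_id s 1) (is_derive_cst _ s 1).
  by move=> h1; apply: is_derive_eq h1 _; rewrite scaler0 add0r /= /GRing.scale /= mulr1.
have K'K x : x \in `]0, r[ -> is_derive x 1 K (q (h + x) - q x - (q h - q 0)).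
  by rewrite in_itv/= => /andP[x0 _]; apply: dK; exact: ltW.
have [|c] := MVT r0 K'K.
  apply: derivable_within_continuous => x; rewrite in_itv/= => /andP[x0 _].
  by have [] := dK x x0.
rewrite in_itv/= => /andP[c0 cr] Kc.
rewrite (_ : _ - _ - _ = K r - K 0); last by rewrite /K addr0 (addrC r h); ring.
rewrite Kc subr0 normrM (gtr0_norm r0) ler_pM2r//.
rewrite (_ : _ - _ - _ = q (h + c) - q h - (q c - q 0)); last by ring.
by apply: qe; rewrite !ltW.
Qed.

End Calculus.

Section GeneratorDomain.
Context {R : realType} {V : normedModType R} (T : R -> {linear V -> V}).
Context (D : set V) (B : V -> V).
Hypothesis T_generator : generates T D B.

(** [B] is a bare function, so linearity of the domain is read off the existence of limits, not off
    [B]. *)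
Lemma generator_domainP u :
  D u <-> exists y : V, h^-1 *: (T h u - u) @[h --> 0^'+] --> y.
Proof.
split=> [Du|[y /T_generator[]//]].
by exists (B u); apply/T_generator.
Qed.

Lemma generator_domain_linear a u v : D u -> D v -> D (a *: u + v).
Proof.
move=> /generator_domainP[y hy] /generator_domainP[z hz]; apply/generator_domainP.
exists (a *: y + z).
have : a *: (h^-1 *: (T h u - u)) + h^-1 *: (T h v - v) @[h --> 0^'+] --> a *: y + z.
  by apply: cvgD => //; apply: cvgZl_tmp.
apply: cvg_trans; apply: near_eq_cvg; apply: nearW => h /=.
rewrite [T h (_ + _)]linearP scalerA mulrC -scalerA -scalerDr scalerBr.
by rewrite opprD addrACA.
Qed.

Lemma generator_domain0 : D 0.
Proof.
apply/generator_domainP; exists 0.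
under eq_fun do rewrite linear0 subr0 scaler0.
exact: cvg_cst.
Qed.

End GeneratorDomain.

Section GeneratorDense.
Context {R : realType} {X : completeNormedModType R} (dot : {dot X for idfun}).
Hypothesis X_hilbert : norm_of_dot dot.
Context (T : R -> {linear X -> X}) (D : set X) (A : X -> X).
Hypothesis T_semigroup : C0_semigroup T.
Hypothesis T_generator : generates T D A.
Local Notation mu := (@lebesgue_measure R).

(* The average of the orbit over [0, h] lies in the domain and tends to [x]. *)
Lemma generator_domain_dense x (e : R) : 0 < e -> exists2 z, D z & `|x - z| <= e.
Proof.
move=> e0.
(* Nothing is assumed of T at negative times; the orbit is extended by the constant x to be
   continuous on the whole line. *)
pose f (s : R) := T (Num.max s 0) x.
have fE s : 0 <= s -> f s = T s x by move=> s0; rewrite /f max_l.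
have cf : continuous f.
  move=> s; have s0 : 0 <= Num.max s 0 by rewrite le_max lexx orbT.
  have /subspace_continuousP/(_ _ s0) := @C0_continuous _ _ _ T_semigroup x.
  move=> h; apply/cvgrPdist_le => e1 e10; move/cvgrPdist_le: h => /(_ e1 e10).
  rewrite near_withinE => h1.
  have cm : Num.max r 0 @[r --> s] --> Num.max s 0.
    exact: (@continuous_max _ _ idfun (cst 0) s (fun=> id) (cvg_cst _)).
  have h2 : nbhs s [set r | 0 <= Num.max r 0 -> `|f s - f r| <= e1] := cm _ h1.
  by apply: filterS h2 => r; apply; rewrite le_max lexx orbT.
have T0 : f 0 = x by rewrite fE// (C0_id T_semigroup).
have [h h0 fh] : exists2 h, 0 < h & forall s, 0 <= s <= h -> `|x - f s| <= e.
  have /cvgrPdist_le/(_ _ e0)[d /= d0 hd] := cf 0.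
  exists (d / 2); first by rewrite divr_gt0.
  move=> s /andP[s0 sd]; rewrite -{1}T0; apply: hd; rewrite /ball/= sub0r normrN ger0_norm//.
  by apply: le_lt_trans sd _; rewrite ltr_pdivrMr// ltr_pMr// ltr1n.
pose J : set R := `[0, h]%classic.
have mJ : measurable J by exact: measurable_itv.
have muJ : mu J = h%:E by rewrite lebesgue_measure_itv/= lte_fin h0 oppr0 adde0.
have muJoo : (mu J < +oo)%E by rewrite muJ ltry.
have Jcst c : \int[mu]_(s in J) c = h * c.
  by rewrite Rintegral_cst// mulrC; congr (_ * _); exact: (congr1 fine muJ).
have sf : strongly_measurable J f.
  exact: (strongly_measurable_comp (q := idfun) mJ (@measurable_id _ _ J) cf).
have if_ : mu.-integrable J (EFin \o (fun s => `|f s|)).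
  apply: continuous_compact_integrable; first exact: segment_compact.
  by apply: continuous_subspaceT => s; apply: cvg_norm; exact: cf.
have [v bv] := @is_bochner_exists _ _ R X dot X_hilbert mu J mJ muJoo f sf if_.
have dotv y : dot v y = \int[mu]_(s in J) dot (f s) y.
  exact: is_bochner_dot bv.
have cq y : continuous (fun s => dot (f s) y).
  by move=> s; apply: dot_cvgl => //; exact: cf.
have iq y : mu.-integrable J (EFin \o (fun s => dot (f s) y)).
  by apply: integrable_dot.
(* The distance to x is bounded by duality: [w] = h x - v is paired with itself under the integral,
   and one factor |w| cancels. *)
exists (h^-1 *: v); last first.
  have hu : h * `|x - h^-1 *: v| <= h * e.
    rewrite -{1}(gtr0_norm h0) -normrZ scalerBr scalerA mulfV ?gt_eqF// scale1r.
    set w := _ - v; have [->|w0] := eqVneq w 0; first by rewrite normr0 mulr_ge0// ltW.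
    rewrite -(@ler_pM2r _ `|w|) ?normr_gt0// -expr2 X_hilbert {1}/w dotBl dotv.
    have -> : dot (h *: x) w = \int[mu]_(s in J) dot x w.
      by rewrite Jcst dotZl.
    have ic : mu.-integrable J (EFin \o (fun=> dot x w)).
      by apply: (@integrable_bounded _ _ R mu J mJ _ `|dot x w|).
    rewrite -RintegralB//.
    rewrite (_ : h * e * `|w| = \int[mu]_(s in J) (e * `|w|)); last first.
      by rewrite Jcst; ring.
    apply: le_Rintegral => //.
    - exact: integrable_sub.
    - by apply: (@integrable_bounded _ _ R mu J mJ _ `|e * `|w| |).
    move=> s; rewrite /J/= in_itv/= => sh; rewrite -dotBl.
    apply: le_trans (ler_norm _) _; apply: le_trans (dot_le X_hilbert _ _) _.
    by rewrite ler_wpM2r// fh.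
  by rewrite -(ler_pM2l h0).
rewrite -[_ *: v]addr0; apply: (generator_domain_linear T_generator);
  last exact: generator_domain0 T_generator.
(* Translating the interval [0, h] by r trades a piece of length r at 0 for one at h, so T r v - v
   is close to r (T h x - x). *)
apply/(generator_domainP T_generator); exists (f h - x).
apply/cvgrPdist_le => e1 e10.
have e12 : 0 < e1 / 2 by rewrite divr_gt0.
(* The radius [d] is taken from norm continuity of the orbit, before any pairing, because the test
   vector [w] below depends on r. *)
have [d d0 hd] : exists2 d, 0 < d & forall s, 0 <= s < d ->
    `|f (h + s) - f h - (f s - f 0)| <= e1.
  have := cf h => /cvgrPdist_le/(_ _ e12)[d1 /= d10 hd1].
  have := cf 0 => /cvgrPdist_le/(_ _ e12)[d2 /= d20 hd2].
  exists (Num.min d1 d2); first by rewrite lt_min d10.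
  move=> s /andP[s0]; rewrite lt_min => /andP[sd1 sd2].
  apply: le_trans (ler_normB _ _) _; rewrite [leRHS]splitr; apply: lerD.
    rewrite distrC; apply: hd1; rewrite /ball/= opprD addrA subrr sub0r normrN.
    by rewrite ger0_norm.
  by rewrite distrC; apply: hd2; rewrite /ball/= sub0r normrN ger0_norm.
near=> r.
have r0 : 0 < r by near: r; exact: nbhs_right_gt.
have rd : r < d by near: r; exact: nbhs_right_lt.
set w := _ - _.
have [->|w0] := eqVneq w 0; first by rewrite normr0 ltW.
have nw : 0 < `|w| by rewrite normr_gt0.
rewrite -(ler_pM2r nw) -expr2 X_hilbert -(ler_pM2l r0).
(* [T r] passes under the integral because z |-> <T r z, w> is a bounded functional. *)
have bTr : dot (T r v) w = \int[mu]_(s in J) dot (f (s + r)) w.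
  have cTr := C0_bounded T_semigroup (ltW r0).
  rewrite (@is_bochner_functional _ _ _ _ mu J mJ muJoo (fun z => dot (T r z) w)
    (opnorm (T r) * `|w|) _ _ _ _ f v)//.
  - apply: eq_Rintegral => s /set_mem; rewrite /J/= in_itv/= => /andP[s0 _].
    rewrite !fE ?addr_ge0// ?(ltW r0)//.
    by rewrite -(C0_add T_semigroup) ?(ltW r0)// addrC.
  - by move=> a b /=; rewrite -dotDl -linearD.
  - by move=> a b /=; rewrite -dotZl -linearZ.
  - by rewrite mulr_ge0// opnorm_ge0.
  - move=> z; apply: le_trans (dot_le X_hilbert _ _) _.
    by rewrite mulrAC ler_wpM2r// opnorm_bound.
have := @integral_shift_le R (fun s => dot (f s) w) h r (e1 * `|w|) (cq w) (ltW h0) (ltW r0).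
rewrite -bTr -dotv T0 => H.
have {H} : `|dot (T r v) w - dot v w - r * (dot (f h) w - dot x w)| <= e1 * `|w| * r.
  apply: H => s /andP[s0 sr]; rewrite -!dotBl.
  apply: le_trans (dot_le X_hilbert _ _) _; rewrite ler_wpM2r// -T0.
  by apply: hd; rewrite s0 (le_lt_trans sr).
move=> H; rewrite [leRHS]mulrC; apply: le_trans H.
apply: le_trans (ler_norm _) _; rewrite -normrN le_eqVlt; apply/orP; left; apply/eqP.
congr (`| _ |); rewrite /w dotBl dotZl !dotBl.
by field; rewrite gt_eqF.
Unshelve. all: by end_near. Qed.

End GeneratorDense.

(** * The space L2 *)

Section L2Space.
Context {R : realType} {X : normedModType R} (dot : {dot X for idfun}).
Hypothesis X_hilbert : norm_of_dot dot.
Local Notation mu := (@lebesgue_measure R).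
Local Notation I := (`[-1, 0]%classic : set R).

Lemma measurable_delay_itv : measurable I. Proof. exact: measurable_itv. Qed.
Hint Resolve measurable_delay_itv : core.

Lemma lebesgue_delay_itv : mu I = 1%:E.
Proof.
by rewrite lebesgue_measure_itv/= lte_fin ltrN10 -EFinD sub0r opprK.
Qed.

Lemma lebesgue_delay_itv_lty : (mu I < +oo)%E.
Proof. by rewrite lebesgue_delay_itv ltry. Qed.
Hint Resolve lebesgue_delay_itv_lty : core.

Let integrable_addI (f g : R -> R) : mu.-integrable I (EFin \o f) ->
  mu.-integrable I (EFin \o g) -> mu.-integrable I (EFin \o (fun t => f t + g t)).
Proof. exact: integrable_add. Qed.

Let integrable_mullI (c : R) (f : R -> R) : mu.-integrable I (EFin \o f) ->
  mu.-integrable I (EFin \o (fun t => c * f t)).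
Proof. exact: integrable_mull. Qed.

Lemma integrable_sqr_L2 (f : L2fun X) : mu.-integrable I (EFin \o (fun t => `|f t| ^+ 2)).
Proof.
apply/integrableP; split.
  by apply/measurable_EFinP; apply: measurable_funX; apply: strongly_measurable_norm => //;
    exact: L2fun_measurable.
have /L2predP[_] := L2valP f; apply: le_lt_trans.
rewrite /L2sqnorm le_eqVlt; apply/orP; left; apply/eqP.
by apply: eq_integral => t _; rewrite /= ger0_norm// sqr_ge0.
Qed.

Lemma integrable_norm_L2 (f : L2fun X) : mu.-integrable I (EFin \o (fun t => `|f t|)).
Proof.
have i1 : mu.-integrable I (EFin \o (fun=> 1)).
  by apply: (@integrable_bounded _ _ R mu I _ _ 1) => // t _; rewrite normr1.
apply: (@integrable_dominated _ _ R mu I _ _ (fun t => 1 + `|f t| ^+ 2)) => //.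
- by apply: strongly_measurable_norm => //; exact: L2fun_measurable.
- by apply: integrable_add => //; exact: integrable_sqr_L2.
move=> t _; rewrite normr_id; move: (`|f t|) => a.
by have := sqr_ge0 (a - 1); nra.
Qed.

Lemma L2fun_exists (f : R -> X) : strongly_measurable I f ->
  mu.-integrable I (EFin \o (fun t => `|f t| ^+ 2)) ->
  exists F : L2fun X, L2val F = f.
Proof.
move=> mf /integrableP[_ i_f].
have pf : f \in @L2pred R X.
  apply/L2predP; split => //; apply: le_lt_trans i_f.
  rewrite /L2sqnorm le_eqVlt; apply/orP; left; apply/eqP.
  by apply: eq_integral => t _; rewrite /= ger0_norm// sqr_ge0.
by exists (MkL2fun pf).
Qed.

Lemma sqr_norm_L2 (u : L2 X) : `|u| ^+ 2 = \int[mu]_(t in I) `|L2rep u t| ^+ 2.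
Proof. exact: sqr_L2norm. Qed.

Lemma sqr_norm_L2class (f : L2fun X) :
  `|L2class f| ^+ 2 = \int[mu]_(t in I) `|f t| ^+ 2.
Proof.
change (L2norm (L2class f) ^+ 2 = \int[mu]_(t in I) `|f t| ^+ 2).
rewrite L2norm_class sqr_sqrtr//.
by rewrite fine_ge0// L2sqnorm_ge0.
Qed.

Lemma measurable_dot_L2 (f g : L2fun X) : measurable_fun I (fun t => dot (f t) (g t)).
Proof. by apply: measurable_dot => //; exact: L2fun_measurable. Qed.

Lemma integrable_dot_L2 (f g : L2fun X) :
  mu.-integrable I (EFin \o (fun t => dot (f t) (g t))).
Proof.
apply: (@integrable_dominated _ _ R mu I _ _ (fun t => `|f t| ^+ 2 + `|g t| ^+ 2)) => //.
- exact: measurable_dot_L2.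
- by apply: integrable_add => //; exact: integrable_sqr_L2.
move=> t _; apply: le_trans (dot_le X_hilbert _ _) _.
have := normr_ge0 (f t); have := normr_ge0 (g t).
move: (`|f t|) (`|g t|) => a b; nra.
Qed.

Lemma sqr_norm_L2D (u v : L2 X) (h : R) :
  `|u + h *: v| ^+ 2 = `|u| ^+ 2 +
    2 * h * (\int[mu]_(t in I) dot (L2rep u t) (L2rep v t)) + h ^+ 2 * `|v| ^+ 2.
Proof.
have -> : u + h *: v = L2class (L2rep u + h *: L2rep v).
  by rewrite L2classD L2classZ !L2repK.
rewrite sqr_norm_L2class !sqr_norm_L2.
have i1 := integrable_sqr_L2 (L2rep u); have i2 := integrable_sqr_L2 (L2rep v).
have i3 := integrable_dot_L2 (L2rep u) (L2rep v).
have i4 := integrable_mullI (2 * h) i3.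
have i5 := integrable_mullI (h ^+ 2) i2.
have i6 := integrable_addI i1 i4.
rewrite -!RintegralZl// -!RintegralD//.
apply: eq_Rintegral => t _.
change (`|L2rep u t + h *: L2rep v t| ^+ 2 = `|L2rep u t| ^+ 2 +
  2 * h * dot (L2rep u t) (L2rep v t) + h ^+ 2 * `|L2rep v t| ^+ 2).
by rewrite (dot_sqrD X_hilbert) (dotZr dot) normrZ exprMn real_normK ?num_real// mulrA.
Qed.

Lemma L2class_dominated (f_ : nat -> L2fun X) (f : L2fun X) (g : R -> R) :
  (forall t, I t -> f_ n t @[n --> \oo] --> f t) ->
  mu.-integrable I (EFin \o g) ->
  (forall n t, I t -> `|f_ n t - f t| ^+ 2 <= g t) ->
  L2class (f_ n) @[n --> \oo] --> L2class f.
Proof.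
move=> cf ig fg.
have sm n : strongly_measurable I (fun t => f_ n t - f t).
  by apply: strongly_measurable_sub; exact: L2fun_measurable.
have [_] : mu.-integrable I (EFin \o (fun=> 0 : R)) /\
    \int[mu]_(t in I) `|f_ n t - f t| ^+ 2 @[n --> \oo] --> \int[mu]_(t in I) (0 : R).
  apply: (@Rdominated_convergence _ _ R mu I _ _ _ g) => //.
  - by move=> n; apply: measurable_funX; apply: strongly_measurable_norm => //; exact: sm.
  - move=> t It; rewrite (_ : 0 = `|f t - f t| * `|f t - f t|); last by rewrite subrr normr0 mulr0.
    have h : `|f_ n t - f t| @[n --> \oo] --> `|f t - f t|.
      by apply: cvg_norm; apply: cvgB; [exact: cf|exact: cvg_cst].
    by under eq_fun do rewrite expr2; exact: cvgM.
  - by move=> n t It; rewrite ger0_norm ?sqr_ge0//; exact: fg.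
rewrite Rintegral_cst// mul0r => h.
apply/cvgrPdist_le => e e0.
move/cvgrPdist_le: h => /(_ (e ^+ 2) (exprn_gt0 _ e0)); apply: filterS => n.
have -> : \int[mu]_(t in I) `|f_ n t - f t| ^+ 2 = `|L2class f - L2class (f_ n)| ^+ 2.
  have -> : L2class f - L2class (f_ n) = - L2class (f_ n - f).
    apply/eqP; rewrite -addr_eq0 addrAC -L2classD.
    by rewrite subrKC subrr.
  by rewrite normrN sqr_norm_L2class.
rewrite sub0r normrN ger0_norm ?sqr_ge0//.
by rewrite ler_pXn2r// nnegrE ?normr_ge0// ltW.
Qed.

End L2Space.

(** * Weak derivatives *)

Section SmoothStep.
Context {R : realType}.

(** A quadratic remainder bound gives the derivative of the squared positive part by sign cases
    alone, with no separate limit at the kink. *)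
Lemma is_derive_quadratic (f : R -> R) (x d C : R) :
  (forall h, `|f (x + h) - f x - h * d| <= C * h ^+ 2) -> is_derive x 1 f d.
Proof.
move=> fx.
have cd : h^-1 *: (f (h *: 1 + x) - f x) @[h --> 0^'] --> d.
  apply/cvgrPdist_le => e e0; near=> h.
  have h0 : h != 0 by near: h; exact: nbhs_dnbhs_neq.
  have nh : 0 < `|h| by rewrite normr_gt0.
  rewrite -(ler_pM2l nh) -normrM.
  rewrite (_ : h * _ = - (f (x + h) - f x - h * d)); last first.
    rewrite /GRing.scale/= mulr1 (addrC h x); field.
    by [].
  rewrite normrN; apply: le_trans (fx h) _.
  rewrite -real_normK ?num_real// expr2 mulrCA ler_wpM2l//.
  apply: le_trans (_ : (1 + `|C|) * `|h| <= _).
    by rewrite ler_wpM2r// (le_trans (ler_norm C))// lerDr.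
  have C1 : 0 < 1 + `|C| by rewrite ltr_wpDr.
  rewrite mulrC -ler_pdivlMr//; near: h.
  exists (e / (1 + `|C|)); first by rewrite /= divr_gt0.
  by move=> h; rewrite /ball/= sub0r normrN => /ltW.
apply: DeriveDef; first by apply/cvg_ex; exists d.
exact: cvg_lim cd.
Unshelve. all: by end_near. Qed.

Lemma is_derive_sqr_max (x : R) :
  is_derive x 1 (fun t : R => Num.max t 0 ^+ 2) (2 * Num.max x 0).
Proof.
apply: (@is_derive_quadratic _ _ _ 1) => h; rewrite mul1r ler_norml.
by case: (leP x 0) => hx; case: (leP (x + h) 0) => hxh; apply/andP; split; nra.
Qed.

Lemma continuous_max0 (c : R) : continuous (fun t : R => Num.max (t - c) 0).
Proof.
move=> t; apply: (@continuous_max _ _ (fun t => t - c) (cst 0) t _ (cvg_cst _)).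
by apply: cvgB; [exact: cvg_id|exact: cvg_cst].
Qed.

(* A quadratic spline rising from 0 at [t = 0] to 1 at [t = 1]. *)
Definition smooth_step (t : R) : R :=
  2 * (Num.max t 0 ^+ 2 - 2 * Num.max (t - 2^-1) 0 ^+ 2 + Num.max (t - 1) 0 ^+ 2).

(** The derivative of [smooth_step]: a tent supported in [0, 1], of height 2 and mass 1. Being
    continuous, it makes the spline C^1, which is all that [test_function] requires. *)
Definition smooth_bump (t : R) : R :=
  4 * (Num.max t 0 - 2 * Num.max (t - 2^-1) 0 + Num.max (t - 1) 0).

Lemma is_derive_shift_comp (f : R -> R) (n c t d : R) : is_derive (n * (t - c)) 1 f d ->
  is_derive t 1 (fun t => f (n * (t - c))) (n * d).
Proof.
move=> df; rewrite mulrC; apply: (@is_derive1_comp _ f (fun t => n * (t - c)) t d n df).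
have h := @is_deriveM _ _ (cst n) (fun t => t - c) t 1 0 (1 - 0)
   (is_derive_cst _ _ _) (is_deriveB (is_derive_id _ _) (is_derive_cst _ _ _)).
by apply: is_derive_eq h _; rewrite scaler0 addr0 subr0 /GRing.scale/= mulr1.
Qed.

Lemma is_derive_smooth_step (t : R) : is_derive t 1 smooth_step (smooth_bump t).
Proof.
have d (c : R) : is_derive t 1 (fun t : R => Num.max (t - c) 0 ^+ 2) (2 * Num.max (t - c) 0).
  have := @is_derive_shift_comp (fun t : R => Num.max t 0 ^+ 2) 1 c t _
    (is_derive_sqr_max (1 * (t - c))).
  by rewrite !mul1r; under [fun t => _]eq_fun do rewrite mul1r.
have h1 := is_derive_sqr_max t.
have h2 := @is_deriveM _ _ (cst 2) _ t 1 0 _ (is_derive_cst _ _ _) (d 2^-1).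
have h3 := is_deriveD (is_deriveB h1 h2) (d 1).
have h4 := @is_deriveM _ _ (cst 2) _ t 1 0 _ (is_derive_cst _ _ _) h3.
apply: is_derive_eq h4 _.
by rewrite /= /GRing.scale/= !mulr0 !addr0 /smooth_bump; ring.
Qed.

Lemma continuous_smooth_bump : continuous smooth_bump.
Proof.
move=> t; apply: cvgM; first exact: cvg_cst.
apply: cvgD; last exact: continuous_max0.
apply: cvgB; last by apply: cvgM; [exact: cvg_cst|exact: continuous_max0].
by have := @continuous_max0 0 t; rewrite /continuous_at subr0; under eq_fun do rewrite subr0.
Qed.

Lemma smooth_step_le0 t : t <= 0 -> smooth_step t = 0.
Proof.
move=> t0; rewrite /smooth_step !max_r ?subr_le0 ?(le_trans t0)//; ring.
Qed.

Lemma smooth_step_ge1 t : 1 <= t -> smooth_step t = 1.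
Proof.
move=> t1; rewrite /smooth_step !max_l ?subr_ge0 ?(le_trans _ t1)//; last by lra.
by field.
Qed.

Lemma smooth_step_ge0 t : 0 <= smooth_step t.
Proof.
rewrite /smooth_step; case: (leP t 0) => h0; case: (leP (t - 2^-1) 0) => h1;
  case: (leP (t - 1) 0) => h2; nra.
Qed.

Lemma smooth_step_le1 t : smooth_step t <= 1.
Proof.
rewrite /smooth_step; case: (leP t 0) => h0; case: (leP (t - 2^-1) 0) => h1;
  case: (leP (t - 1) 0) => h2; nra.
Qed.

Lemma smooth_bump_ge0 t : 0 <= smooth_bump t.
Proof.
rewrite /smooth_bump; case: (leP t 0) => h0; case: (leP (t - 2^-1) 0) => h1;
  case: (leP (t - 1) 0) => h2; lra.
Qed.

Lemma smooth_bump_eq0 t : t <= 0 \/ 1 <= t -> smooth_bump t = 0.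
Proof.
rewrite /smooth_bump; case: (leP t 0) => h0; case: (leP (t - 2^-1) 0) => h1;
  case: (leP (t - 1) 0) => h2 [] h3; lra.
Qed.

Lemma is_derive_scaled_step (n c t : R) :
  is_derive t 1 (fun t => smooth_step (n * (t - c))) (n * smooth_bump (n * (t - c))).
Proof. by apply: is_derive_shift_comp; exact: is_derive_smooth_step. Qed.

Lemma continuous_scaled_bump (n c : R) :
  continuous (fun t => n * smooth_bump (n * (t - c))).
Proof.
move=> t; apply: cvgM; first exact: cvg_cst.
apply: continuous_cvg; first exact: continuous_smooth_bump.
apply: cvgM; first exact: cvg_cst.
by apply: cvgB; [exact: cvg_id|exact: cvg_cst].
Qed.

Lemma scaled_step_cvg (x t : R) :
  smooth_step (n%:R * (t - x)) @[n --> \oo] --> (\1_(`]x, +oo[%classic : set R) t : R).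
Proof.
have [tx|xt] := leP t x.
  rewrite indicE memNset/=; last by rewrite in_itv/= andbT ltNge tx.
  under eq_fun do rewrite smooth_step_le0 ?mulr_ge0_le0 ?subr_le0//.
  exact: cvg_cst.
rewrite indicE mem_set/=; last by rewrite in_itv/= xt.
apply: cvg_near_cst; near=> n; apply: smooth_step_ge1.
rewrite -ler_pdivrMr ?subr_gt0// ltW//; near: n; exact: nbhs_infty_gtr.
Unshelve. all: by end_near. Qed.

End SmoothStep.

Section WeakDerivative.
Context {R : realType} {X : completeNormedModType R} (dot : {dot X for idfun}).
Hypothesis X_hilbert : norm_of_dot dot.
Local Notation mu := (@lebesgue_measure R).
Local Notation I := (`[-1, 0]%classic : set R).
Let mI := @measurable_delay_itv R.
Let muI := @lebesgue_delay_itv_lty R.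

Lemma continuous_bounded_itv (phi : R -> R) : continuous phi ->
  exists M, forall t, I t -> `|phi t| <= M.
Proof.
move=> cphi; have /compact_bounded[M [_ hM]] :
    compact (phi @` I).
  by apply: continuous_compact; [exact: continuous_subspaceT|exact: segment_compact].
exists (M + 1) => t It; apply: (hM (M + 1)); first by rewrite ltrDl.
by exists t.
Qed.

Lemma strongly_measurable_scale_L2 (phi : R -> R) (f : L2fun X) : continuous phi ->
  strongly_measurable I (fun t => phi t *: f t).
Proof.
move=> cphi; apply: strongly_measurable_scale => //; last exact: L2fun_measurable.
by apply: measurable_funTS; exact: continuous_measurable_fun.
Qed.

Lemma integrable_scale_L2 (phi : R -> R) (f : L2fun X) : continuous phi ->
  mu.-integrable I (EFin \o (fun t => `|phi t *: f t|)).
Proof.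
move=> cphi; have [M hM] := continuous_bounded_itv cphi.
apply: (@integrable_dominated _ _ R mu I mI _ (fun t => M * `|f t|)).
- apply: strongly_measurable_norm => //; exact: strongly_measurable_scale_L2.
- by apply: integrable_mull => //; exact: integrable_norm_L2.
- by move=> t It; rewrite normr_id normrZ ler_wpM2r// hM.
Qed.

Lemma bochner_scale_L2 (phi : R -> R) (f : L2fun X) : continuous phi ->
  exists v, is_bochner mu I (fun t => phi t *: f t) v.
Proof.
move=> cphi; apply: (@is_bochner_exists _ _ R X dot X_hilbert mu I mI muI).
  exact: strongly_measurable_scale_L2.
exact: integrable_scale_L2.
Qed.

Lemma bochner_scale_L2_dot (phi : R -> R) (f : L2fun X) v y : continuous phi ->
  is_bochner mu I (fun t => phi t *: f t) v ->
  dot v y = \int[mu]_(t in I) (phi t * dot (f t) y).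
Proof.
move=> cphi bv.
rewrite (@is_bochner_dot _ _ R X dot X_hilbert mu I mI muI _ _ y _ _ bv).
- by apply: eq_Rintegral => t _; rewrite dotZl.
- exact: strongly_measurable_scale_L2.
- exact: integrable_scale_L2.
Qed.

Lemma test_function_continuous (phi : R -> R) : test_function phi ->
  continuous phi /\ continuous (derive1 phi).
Proof.
move=> [dphi cphi _]; split => // t.
by apply/differentiable_continuous/derivable1_diffP; exact: dphi.
Qed.

Lemma weak_derivative_dot (f g : L2 X) (phi : R -> R) y : weak_derivative f g ->
  test_function phi ->
  \int[mu]_(t in I) (derive1 phi t * dot (L2rep f t) y) =
  - \int[mu]_(t in I) (phi t * dot (L2rep g t) y).
Proof.
move=> fg tphi; have [cphi cphi'] := test_function_continuous tphi.
have [v [b1 b2]] := fg phi tphi.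
rewrite -(bochner_scale_L2_dot y cphi' b1) -(bochner_scale_L2_dot y cphi b2).
by rewrite dotNl opprK.
Qed.

(** The two Bochner integrals exist since a continuous scalar times an L2 function is integrable.
    Their sum is orthogonal to every vector, hence to itself. *)
Lemma weak_derivativeP (f g : L2 X) :
  (forall phi y, test_function phi ->
    \int[mu]_(t in I) (derive1 phi t * dot (L2rep f t) y) =
    - \int[mu]_(t in I) (phi t * dot (L2rep g t) y)) ->
  weak_derivative f g.
Proof.
move=> fg phi tphi; have [cphi cphi'] := test_function_continuous tphi.
have [v bv] := bochner_scale_L2 (L2rep f) cphi'.
have [w bw] := bochner_scale_L2 (L2rep g) cphi.
exists v; split => //; suff -> : - v = w by [].
apply/eqP; rewrite eq_sym -addr_eq0; apply/eqP.
have vw y : dot (w + v) y = 0.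
  rewrite dotDl (bochner_scale_L2_dot y cphi bw) (bochner_scale_L2_dot y cphi' bv).
  by rewrite fg// subrr.
apply/eqP; rewrite -normr_eq0 -sqrf_eq0 X_hilbert vw.
by [].
Qed.

Lemma eq_Rintegral_ae (f g : R -> R) : measurable_fun I f -> measurable_fun I g ->
  {ae mu, forall t, I t -> f t = g t} ->
  \int[mu]_(t in I) f t = \int[mu]_(t in I) g t.
Proof.
move=> mf mg fg; congr fine; apply: ae_eq_integral => //.
- exact/measurable_EFinP.
- exact/measurable_EFinP.
have FF := ae_filter_ringOfSetsType mu.
by apply: filterS fg => t h It; rewrite h.
Qed.

Lemma test_function_bounds (phi : R -> R) : test_function phi ->
  phi (-1) = 0 /\ phi 0 = 0.
Proof.
move=> [_ _ [a [b [a1 b0 ab]]]].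
by split; apply/eqP/negPn/negP => /ab/andP[]; [rewrite leNgt a1|rewrite (leNgt 0) b0].
Qed.

(** Supplies the explicit H1 functions, with known traces, from which density of the delay domain is
    built. *)
Lemma smooth_scale_H1 (phi phi' : R -> R) (y : X) :
  (forall t : R, is_derive t 1 phi (phi' t)) -> continuous phi' ->
  exists F : L2fun X, [/\ L2val F = (fun t => phi t *: y),
    H1 (L2class F) & forall s, value_at (L2class F) s (phi s *: y)].
Proof.
move=> dphi cphi'.
have cphi : continuous phi.
  move=> t; apply/differentiable_continuous/derivable1_diffP.
  by have [] := dphi t.
have L2scale (psi : R -> R) : continuous psi ->
    exists F : L2fun X, L2val F = (fun t => psi t *: y).
  move=> cpsi; apply: L2fun_exists.
    apply: strongly_measurable_scale => //; last exact: strongly_measurable_cst.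
    by apply: measurable_funTS; exact: continuous_measurable_fun.
  apply: continuous_compact_integrable; first exact: segment_compact.
  apply: continuous_subspaceT => t; rewrite /continuous_at.
  under eq_fun do rewrite expr2; rewrite expr2.
  by apply: cvgM; apply: cvg_norm; apply: cvgZr_tmp; exact: cpsi.
have [F FE] := L2scale phi cphi; have [G GE] := L2scale phi' cphi'.
exists F; split=> //; last first.
  move=> s; exists (fun t => phi t *: y); split => //.
    by apply: continuous_subspaceT => t; apply: cvgZr_tmp; exact: cphi.
  have FF := ae_filter_ringOfSetsType mu.
  by apply: filterS (L2rep_ae F) => t h It; rewrite h// FE.
exists (L2class G); apply: weak_derivativeP => theta z ttheta.
have [ctheta ctheta'] := test_function_continuous ttheta.
have mscale (p : R -> R) (f : L2fun X) : continuous p ->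
    measurable_fun I (fun t => p t * dot (f t) z).
  move=> cp; apply: measurable_funM.
    by apply: measurable_funTS; exact: continuous_measurable_fun.
  by apply: measurable_dot => //; [exact: L2fun_measurable|exact: strongly_measurable_cst].
have ae (p : R -> R) (f : L2fun X) : continuous p ->
    \int[mu]_(t in I) (p t * dot (L2rep (L2class f) t) z) =
    \int[mu]_(t in I) (p t * dot (f t) z).
  move=> cp; apply: eq_Rintegral_ae; [exact: mscale|exact: mscale|].
  have FF := ae_filter_ringOfSetsType mu.
  by apply: filterS (L2rep_ae f) => t h It; rewrite h.
rewrite !ae// FE GE.
have cM (p q : R -> R) : continuous p -> continuous q ->
    continuous (fun t => p t * dot (q t *: y) z).
  move=> cp cq t; apply: cvgM; first exact: cp.
  by apply: dot_cvgl => //; apply: cvgZr_tmp; exact: cq.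
have i_ (p q : R -> R) : continuous p -> continuous q ->
    mu.-integrable I (EFin \o (fun t => p t * dot (q t *: y) z)).
  move=> cp cq; apply: continuous_compact_integrable; first exact: segment_compact.
  by apply: continuous_subspaceT; exact: cM.
apply/eqP; rewrite -addr_eq0; apply/eqP.
rewrite -RintegralD//; [|exact: i_..].
have [th1 th0] := test_function_bounds ttheta.
(* Integration by parts: the boundary terms vanish because the test function is 0 at both ends. *)
transitivity (theta 0 * (phi 0 * dot y z) - theta (-1) * (phi (-1) * dot y z));
  last by rewrite th1 th0 !mul0r subrr.
apply: (@Rintegral_is_derive _ (fun t => theta t * (phi t * dot y z))
  (fun t => derive1 theta t * dot (phi t *: y) z + theta t * dot (phi' t *: y) z)).
- by rewrite lerN10.
- by apply: continuous_subspaceT => t; apply: cvgD; exact: cM.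
move=> t _.
have dth : is_derive t 1 theta (derive1 theta t).
  by apply: DeriveDef; [case: ttheta => + _ _; exact|rewrite derive1E].
have h1 := @is_deriveM _ _ _ (cst (dot y z)) t 1 _ 0 (dphi t) (is_derive_cst _ _ _).
have h2 := is_deriveM dth h1.
apply: is_derive_eq h2 _.
rewrite /= /GRing.scale/= mulr0 add0r !dotZl.
by change ((phi * cst (dot y z)) t) with (phi t * dot y z); ring.
Qed.

End WeakDerivative.

Lemma near_infty_inv_lt (R : realType) (e : R) : 0 < e ->
  \forall n \near \oo, 0 < n%:R :> R /\ (n%:R^-1 : R) < e.
Proof.
move=> e0; have := nbhs_infty_gtr (e^-1); apply: filterS => n h.
have n0 : 0 < n%:R :> R by apply: lt_trans h; rewrite invr_gt0.
by split => //; rewrite -(invrK e) ltf_pV2// posrE invr_gt0.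
Qed.

(** * Continuous representatives and their values *)

Section Sobolev.
Context {R : realType} {X : completeNormedModType R} (dot : {dot X for idfun}).
Hypothesis X_hilbert : norm_of_dot dot.
Local Notation mu := (@lebesgue_measure R).
Local Notation I := (`[-1, 0]%classic : set R).
Let mI := @measurable_delay_itv R.
Let muI := @lebesgue_delay_itv_lty R.

Lemma value_at_continuous (f : L2 X) (s : R) (x : X) : I s -> value_at f s x ->
  exists F : R -> X, [/\ continuous F,
    {ae mu, forall t, I t -> L2rep f t = F t} & F s = x].
Proof.
move=> Is [fc [cfc ffc fcs]].
(* Constant extension beyond [-1, 0] turns continuity within the interval into continuity on the
   line, endpoints included. *)
pose clamp (t : R) := Num.max (Num.min t 0) (-1).
have clampI t : I (clamp t).
  rewrite /= in_itv/= /clamp le_max lexx orbT/= ge_max lerN10 andbT.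
  by rewrite ge_min lexx orbT.
have clampE t : I t -> clamp t = t.
  by rewrite /= in_itv/= /clamp => /andP[t1 t0]; rewrite min_l// max_l.
have cclamp : continuous clamp.
  move=> t; have h : {for t, continuous (fun t : R => Num.min t 0)}.
    exact: (@continuous_min _ _ idfun (cst 0) t (fun=> id) (cvg_cst _)).
  exact: (@continuous_max _ _ (fun t : R => Num.min t 0) (cst (-1)) t h (cvg_cst _)).
exists (fc \o clamp); split; last by rewrite /= clampE.
  move=> t; have /subspace_continuousP/(_ _ (clampI t)) := cfc.
  move=> h; apply/cvgrPdist_le => e e0; move/cvgrPdist_le: h => /(_ e e0).
  rewrite near_withinE => h1.
  have h2 : nbhs t [set r | I (clamp r) -> `|fc (clamp t) - fc (clamp r)| <= e] :=
    cclamp t _ h1.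
  by apply: filterS h2 => r; apply.
have FF := ae_filter_ringOfSetsType mu.
by apply: filterS ffc => t h It; rewrite /= clampE// h.
Qed.

(** If the values at -1 differed, the functions would differ on some [-1, -1 + q], which has
    positive measure. This makes [H1_eval] at -1 independent of the choice made by [xget]. *)
Lemma continuous_ae_eq_left (F1 F2 : R -> X) : continuous F1 -> continuous F2 ->
  {ae mu, forall t, I t -> F1 t = F2 t} -> F1 (-1) = F2 (-1).
Proof.
move=> c1 c2 [N [mN N0 subN]].
apply/eqP; rewrite -subr_eq0 -normr_eq0; apply/negPn/negP => d0.
set d := F1 (-1) - F2 (-1) in d0.
have nd : 0 < `|d| by rewrite lt_def d0 normr_ge0.
have cd : F1 t - F2 t @[t --> (-1 : R)] --> d by apply: cvgB; [exact: c1|exact: c2].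
move/cvgrPdist_lt: cd => /(_ _ nd)[r /= r0 hr].
pose q := Num.min (r / 2) 1.
have q0 : 0 < q by rewrite lt_min ltr01 divr_gt0.
have q1 : q <= 1 by rewrite /q ge_min lexx orbT.
have qr : q < r by rewrite /q gt_min ltr_pdivrMr// ltr_pMr// ltr1n.
have sub : `[-1, -1 + q]%classic `<=` N.
  move=> t /=; rewrite in_itv/= => /andP[t1 tq]; apply: subN => /= h.
  have It : I t by rewrite /= in_itv/= t1/=; lra.
  have := hr t; rewrite /ball/= (h It) subrr subr0 ltxx => hF.
  suff : false by [].
  apply: hF.
  rewrite ltr_norml; apply/andP; split; lra.
pose J : set R := `[-1, -1 + q]%classic.
have : (mu J <= mu N)%E.
  by apply: le_measure => //; apply: mem_set => //; exact: measurable_itv.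
rewrite N0 lebesgue_measure_itv/= lte_fin ltrDl q0 -EFinD lee_fin opprK addrC addrA subrr add0r.
by rewrite leNgt q0.
Qed.

(** The rescaled bumps form an approximate identity supported in [c n, c n + 1/n]. The moving base
    point keeps this support inside [-1, 0], hence the mass equal to 1, even when x is an
    endpoint. *)
Lemma bump_integral_cvg (p : R -> R) (x : R) (c : nat -> R) : continuous p ->
  c n @[n --> \oo] --> x ->
  (\forall n \near \oo, -1 <= c n /\ c n + n%:R^-1 <= 0) ->
  \int[mu]_(r in I) (n%:R * smooth_bump (n%:R * (r - c n)) * p r) @[n --> \oo] --> p x.
Proof.
move=> cp cx cI; apply/cvgrPdist_le => e e0.
move/cvgrPdist_le: (cp x) => /(_ _ e0)[d /= d0 hd].
have d2 : 0 < d / 2 by rewrite divr_gt0.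
have hN := near_infty_inv_lt d2; move/cvgrPdist_lt: cx => /(_ _ d2) hx.
near=> n.
have [c1 c2] : -1 <= c n /\ c n + n%:R^-1 <= 0 by near: n; exact: cI.
have cxn : `|x - c n| < d / 2 by near: n; exact: hx.
have [n0 nd] : 0 < n%:R :> R /\ (n%:R^-1 : R) < d / 2 by near: n; exact: hN.
pose b r := n%:R * smooth_bump (n%:R * (r - c n)).
have cb : continuous b by exact: continuous_scaled_bump.
have b0 r : 0 <= b r by rewrite mulr_ge0 ?smooth_bump_ge0// ltW.
have bi (q : R -> R) : continuous q -> mu.-integrable I (EFin \o (fun r => b r * q r)).
  move=> cq; apply: continuous_compact_integrable; first exact: segment_compact.
  by apply: continuous_subspaceT => r; apply: cvgM; [exact: cb|exact: cq].
have bI : \int[mu]_(r in I) b r = 1.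
  transitivity (smooth_step (n%:R * (0 - c n)) - smooth_step (n%:R * (-1 - c n))); last first.
    rewrite smooth_step_ge1; last by rewrite -ler_pdivrMl// mulr1; lra.
    by rewrite smooth_step_le0 ?subr0// pmulr_rle0//; lra.
  apply: (@Rintegral_is_derive _ (fun r => smooth_step (n%:R * (r - c n)))).
  - by rewrite lerN10.
  - exact: continuous_subspaceT.
  - by move=> r _; exact: is_derive_scaled_step.
have b1 (k : R) : \int[mu]_(r in I) (b r * k) = k.
  rewrite RintegralZr ?bI ?mul1r//.
  apply: continuous_compact_integrable; first exact: segment_compact.
  exact: continuous_subspaceT.
rewrite -[p x]b1 -RintegralB//; [|exact: (bi (cst (p x)) (fun=> cvg_cst _))|exact: bi].
have bp : mu.-integrable I (EFin \o (fun r => b r * p x - b r * p r)).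
  by apply: integrable_sub => //; [exact: (bi (cst (p x)) (fun=> cvg_cst _))|exact: bi].
apply: (le_trans (le_normr_Rintegral _ _)) => //.
rewrite -[leRHS]b1; apply: le_Rintegral => //.
- exact: (integrable_norm bp).
- exact: (bi (cst e) (fun=> cvg_cst _)).
move=> r _; rewrite -mulrBr normrM (ger0_norm (b0 r)).
have [br|br] := eqVneq (b r) 0; first by rewrite br !mul0r.
apply: ler_wpM2l => //; apply: hd; rewrite /ball/=.
have /andP[r1 r2] : c n < r < c n + n%:R^-1.
  apply/andP; split; rewrite ltNge; apply: contra br => h; rewrite /b smooth_bump_eq0 ?mulr0//.
    by left; rewrite pmulr_rle0// subr_le0.
  by right; rewrite -ler_pdivrMl// mulr1; lra.
apply: le_lt_trans (_ : _ <= `|x - c n| + `|c n - r|) _.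
  by apply: le_trans (ler_normD _ _); rewrite addrA subrK.
rewrite [ltRHS]splitr; apply: ltrD => //; rewrite distrC ger0_norm; lra.
Unshelve. all: by end_near. Qed.

End Sobolev.

(** * The energy identity on [-1, 0] *)

Section Energy.
Context {R : realType} {X : completeNormedModType R} (dot : {dot X for idfun}).
Hypothesis X_hilbert : norm_of_dot dot.
Local Notation mu := (@lebesgue_measure R).
Local Notation I := (`[-1, 0]%classic : set R).
Let mI := @measurable_delay_itv R.
Let muI := @lebesgue_delay_itv_lty R.

Let integrable_dotI (g : L2fun X) y : mu.-integrable I (EFin \o (fun t => dot (g t) y)).
Proof.
apply: integrable_dot => //; first exact: L2fun_measurable.
exact: integrable_norm_L2.
Qed.

(* [smooth_step (n (r - s) - 1)] minus its translate tends to the indicator of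
   ]s, t[ while staying supported in [s + 1/n, t - 1/n]. *)
Definition plateau (s t : R) (n : nat) (r : R) : R :=
  smooth_step (n%:R * (r - (s + n%:R^-1))) -
  smooth_step (n%:R * (r - (t - 2 * n%:R^-1))).

Lemma is_derive_plateau (s t : R) n (r : R) : is_derive r 1 (plateau s t n)
  (n%:R * smooth_bump (n%:R * (r - (s + n%:R^-1))) -
   n%:R * smooth_bump (n%:R * (r - (t - 2 * n%:R^-1)))).
Proof. by apply: is_deriveB; exact: is_derive_scaled_step. Qed.

Lemma plateau_test_function (s t : R) : -1 <= s -> s < t -> t <= 0 ->
  \forall n \near \oo, test_function (plateau s t n).
Proof.
move=> s1 st t0.
(* When 3/n < t - s, both steps vanish to the left of s + 1/n and both equal 1 to the right of t -
   1/n, so their difference has its support in between. *)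
have st3 : 0 < (t - s) / 3 by rewrite divr_gt0// subr_gt0.
near=> n.
have [n0 nd] : 0 < n%:R :> R /\ (n%:R^-1 : R) < (t - s) / 3.
  by near: n; exact: near_infty_inv_lt.
have ni : 0 < (n%:R^-1 : R) by rewrite invr_gt0.
split.
- by move=> r; have [] := is_derive_plateau s t n r.
- have -> : derive1 (plateau s t n) = (fun r : R =>
      n%:R * smooth_bump (n%:R * (r - (s + n%:R^-1))) -
      n%:R * smooth_bump (n%:R * (r - (t - 2 * n%:R^-1)))).
    by apply/funext => r; rewrite derive1E; have [_ ->] := is_derive_plateau s t n r.
  by move=> r; apply: cvgB; exact: continuous_scaled_bump.
exists (s + n%:R^-1), (t - n%:R^-1); split; [by lra|by lra|].
move=> r; apply: contraR; rewrite negb_and -!ltNge /plateau => /orP[h|h].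
  rewrite !smooth_step_le0 ?subrr//; rewrite pmulr_rle0//; lra.
rewrite !smooth_step_ge1 ?subrr//; rewrite -ler_pdivrMl// mulr1; lra.
Unshelve. all: by end_near. Qed.

Lemma plateau_cvg (s t r : R) : s < t ->
  plateau s t n r @[n --> \oo] --> (\1_(`]s, t[%classic : set R) r : R).
Proof.
move=> st; apply: cvg_near_cst.
have ge1 (n : nat) (a : R) : 0 < n%:R :> R -> n%:R^-1 <= a -> smooth_step (n%:R * a) = 1.
  by move=> n0 na; apply: smooth_step_ge1; rewrite -(ler_pM2l n0) mulfV ?gt_eqF in na.
have le0 (n : nat) (a : R) : a <= 0 -> smooth_step (n%:R * a) = 0.
  by move=> a0; apply: smooth_step_le0; rewrite mulr_ge0_le0.
have st3 : 0 < (t - s) / 3 by rewrite divr_gt0// subr_gt0.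
have [sr|rs] := ltP s r; last first.
  rewrite indicE memNset/=; last by rewrite in_itv/= ltNge rs.
  near=> n.
  have [n0 nd] : 0 < n%:R :> R /\ (n%:R^-1 : R) < (t - s) / 3.
    by near: n; exact: near_infty_inv_lt.
  have ni : 0 < (n%:R^-1 : R) by rewrite invr_gt0.
  by rewrite /plateau !le0 ?subrr//; lra.
have [rt|tr] := ltP r t; last first.
  rewrite indicE memNset/=; last by rewrite in_itv/= (ltNge r) tr andbF.
  near=> n.
  have [n0 nd] : 0 < n%:R :> R /\ (n%:R^-1 : R) < (t - s) / 3.
    by near: n; exact: near_infty_inv_lt.
  have ni : 0 < (n%:R^-1 : R) by rewrite invr_gt0.
  by rewrite /plateau !ge1 ?subrr//; lra.
rewrite indicE mem_set/=; last by rewrite in_itv/= sr rt.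
have sr2 : 0 < (r - s) / 2 by rewrite divr_gt0// subr_gt0.
have rt2 : 0 < (t - r) / 2 by rewrite divr_gt0// subr_gt0.
near=> n.
have [n0 n1] : 0 < n%:R :> R /\ (n%:R^-1 : R) < (r - s) / 2.
  by near: n; exact: near_infty_inv_lt.
have [_ n2] : 0 < n%:R :> R /\ (n%:R^-1 : R) < (t - r) / 2.
  by near: n; exact: near_infty_inv_lt.
rewrite /plateau ge1 ?le0 ?subr0//; lra.
Unshelve. all: by end_near. Qed.

Lemma plateau_le1 s t n r : `|plateau s t n r| <= 1.
Proof.
rewrite /plateau; set a := smooth_step _; set b := smooth_step _.
have a0 : 0 <= a := smooth_step_ge0 _; have a1 : a <= 1 := smooth_step_le1 _.
have b0 : 0 <= b := smooth_step_ge0 _; have b1 : b <= 1 := smooth_step_le1 _.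
by rewrite ler_norml; apply/andP; split; lra.
Qed.

(** The weak derivative is tested with plateaus on ]s, t[. Their derivatives are a bump near s minus
    a bump near t and evaluate F in the limit; the plateaus themselves tend boundedly to the
    indicator of ]s, t[. *)
Lemma weak_derivative_increment (f g : L2 X) (F : R -> X) (s t : R) y :
  weak_derivative f g -> continuous F ->
  {ae mu, forall r, I r -> L2rep f r = F r} -> -1 <= s -> s < t -> t <= 0 ->
  dot (F t - F s) y = \int[mu]_(r in `]s, t]) dot (L2rep g r) y.
Proof.
move=> fg cF fF s1 st t0.
have cp : continuous (fun r => dot (F r) y).
  by move=> r; apply: dot_cvgl => //; exact: cF.
have cinv : (n%:R^-1 : R) @[n --> \oo] --> (0 : R).
  apply/cvgrPdist_lt => e e0; have := near_infty_inv_lt e0.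
  by apply: filterS => n [n0 h]; rewrite sub0r normrN gtr0_norm ?invr_gt0.
have st3 : 0 < (t - s) / 3 by rewrite divr_gt0// subr_gt0.
have cs : \int[mu]_(r in I) (n%:R * smooth_bump (n%:R * (r - (s + n%:R^-1))) *
    dot (F r) y) @[n --> \oo] --> dot (F s) y.
  apply: (@bump_integral_cvg _ _ s (fun n => s + n%:R^-1)) => //.
    by rewrite -[X in _ --> X]addr0; apply: cvgD => //; exact: cvg_cst.
  have := near_infty_inv_lt st3; apply: filterS => n [n0 h].
  by have ni : 0 < (n%:R^-1 : R) by [rewrite invr_gt0]; split; lra.
have ct : \int[mu]_(r in I) (n%:R * smooth_bump (n%:R * (r - (t - 2 * n%:R^-1))) *
    dot (F r) y) @[n --> \oo] --> dot (F t) y.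
  apply: (@bump_integral_cvg _ _ t (fun n => t - 2 * n%:R^-1)) => //.
    rewrite -[X in _ --> X]subr0 -[X in _ - X](mulr0 2).
    by apply: cvgB; [exact: cvg_cst|apply: cvgMl_tmp].
  have := near_infty_inv_lt st3; apply: filterS => n [n0 h].
  by have ni : 0 < (n%:R^-1 : R) by [rewrite invr_gt0]; split; lra.
pose u n := \int[mu]_(r in I) (n%:R * smooth_bump (n%:R * (r - (t - 2 * n%:R^-1))) *
    dot (F r) y) - \int[mu]_(r in I) (n%:R * smooth_bump (n%:R * (r - (s + n%:R^-1))) *
    dot (F r) y).
have cl : u n @[n --> \oo] --> dot (F t) y - dot (F s) y by exact: cvgB.
have [iq cr] : mu.-integrable I (EFin \o (fun r => \1_(`]s, t[%classic : set R) r * dot (L2rep g r) y)) /\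
    \int[mu]_(r in I) (plateau s t n r * dot (L2rep g r) y) @[n --> \oo] -->
    \int[mu]_(r in I) (\1_(`]s, t[%classic : set R) r * dot (L2rep g r) y).
  apply: (@Rdominated_convergence _ _ R mu I mI _ _ (fun r => `|dot (L2rep g r) y|)).
  - move=> n; apply: measurable_funM; last first.
      by apply: measurable_dot => //; [exact: L2fun_measurable|exact: strongly_measurable_cst].
    apply: measurable_funTS; apply: continuous_measurable_fun => r.
    apply/differentiable_continuous/derivable1_diffP.
    by have [] := is_derive_plateau s t n r.
  - by move=> r _; apply: cvgMr_tmp; exact: plateau_cvg.
  - exact: (integrable_norm (integrable_dotI (L2rep g) y)).
  - by move=> n r _; rewrite normrM ler_piMl// plateau_le1.
have -> : \int[mu]_(r in `]s, t]) dot (L2rep g r) y =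
    \int[mu]_(r in I) (\1_(`]s, t[%classic : set R) r * dot (L2rep g r) y).
  have sub : (`]s, t[%classic : set R) `<=` I.
    by move=> r; rewrite /= !in_itv/= => /andP[sr rt]; lra.
  rewrite -Rintegral_itv_bndo_bndc; last first.
    by apply: integrableS (integrable_dotI (L2rep g) y) => //; exact: measurable_itv.
  rewrite -{1}(setIidr sub) Rintegral_mkcondr; apply: eq_Rintegral => r _.
  by rewrite patchE indicE; case: ifPn => _; rewrite ?mul1r ?mul0r.
rewrite dotBl.
suff cu : u n @[n --> \oo] -->
    \int[mu]_(r in I) (\1_(`]s, t[%classic : set R) r * dot (L2rep g r) y).
  exact: (cvg_unique _ cl cu).
apply: cvg_trans cr; apply: near_eq_cvg.
have := plateau_test_function s1 st t0; apply: filterS => n tn.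
have := weak_derivative_dot X_hilbert y fg tn => /(congr1 -%R); rewrite opprK => <-.
have cb c : continuous (fun r : R => n%:R * smooth_bump (n%:R * (r - c)) * dot (F r) y).
  by move=> r; apply: cvgM; [exact: continuous_scaled_bump|exact: cp].
have ib c : mu.-integrable I
    (EFin \o (fun r : R => n%:R * smooth_bump (n%:R * (r - c)) * dot (F r) y)).
  apply: continuous_compact_integrable; first exact: segment_compact.
  exact: continuous_subspaceT.
have -> : \int[mu]_(r in I) (derive1 (plateau s t n) r * dot (L2rep f r) y) =
    \int[mu]_(r in I) (n%:R * smooth_bump (n%:R * (r - (s + n%:R^-1))) * dot (F r) y) -
    \int[mu]_(r in I) (n%:R * smooth_bump (n%:R * (r - (t - 2 * n%:R^-1))) * dot (F r) y).
  rewrite -RintegralB//; apply: eq_Rintegral_ae.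
  - apply: measurable_funM.
      have [_ cd _] := tn.
      by apply: measurable_funTS; exact: continuous_measurable_fun.
    by apply: measurable_dot => //; [exact: L2fun_measurable|exact: strongly_measurable_cst].
  - apply: measurable_funB; apply: measurable_funTS; apply: continuous_measurable_fun;
      exact: cb.
  have FF := ae_filter_ringOfSetsType mu.
  apply: filterS fF => r h Ir; rewrite h// -mulrBl derive1E.
  by have [_ ->] := is_derive_plateau s t n r.
by rewrite opprB.
Qed.

(* Real induction along [-1, 0]: on a short interval the increment of |F|^2
   differs from twice the integral of <F, g> by at most e times that of |g|. *)
Lemma weak_derivative_energy (f g : L2 X) (F : R -> X) :
  weak_derivative f g -> continuous F ->
  {ae mu, forall r, I r -> L2rep f r = F r} ->
  2 * \int[mu]_(r in I) dot (L2rep f r) (L2rep g r) = `|F 0| ^+ 2 - `|F (-1)| ^+ 2.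
Proof.
move=> fg cF fF.
have [M hM] : exists M, forall t, I t -> `|F t| <= M.
  have [|M hM] := continuous_bounded_itv (phi := fun t => `|F t|).
    by move=> t; apply: cvg_norm; exact: cF.
  by exists M => t /hM; rewrite normr_id.
have sF : strongly_measurable I F.
  exact: (strongly_measurable_comp (q := idfun) mI (@measurable_id _ _ I) cF).
pose w r := dot (F r) (L2rep g r).
have mw : measurable_fun I w by apply: measurable_dot => //; exact: L2fun_measurable.
have ig := integrable_norm_L2 (L2rep g).
have iw : mu.-integrable I (EFin \o w).
  apply: (@integrable_dominated _ _ R mu I mI _ (fun t => M * `|L2rep g t|)) => //.
    exact: integrable_mull.
  move=> t It; apply: le_trans (dot_le X_hilbert _ _) _.
  by rewrite ler_wpM2r// hM.
have -> : \int[mu]_(r in I) dot (L2rep f r) (L2rep g r) = \int[mu]_(r in I) w r.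
  apply: eq_Rintegral_ae => //; first exact: measurable_dot_L2.
  have FF := ae_filter_ringOfSetsType mu.
  by apply: filterS fF => r h Ir; rewrite h.
have sub (s t : R) : -1 <= s -> t <= 0 -> (`]s, t]%classic : set R) `<=` I.
  by move=> s1 t0 r; rewrite /= !in_itv/= => /andP[sr rt]; lra.
have iS (h : R -> R) (s t : R) : mu.-integrable I (EFin \o h) -> -1 <= s -> t <= 0 ->
    mu.-integrable (`]s, t]%classic : set R) (EFin \o h).
  by move=> ih s1 t0; apply: integrableS ih => //; exact: sub.
have split (h : R -> R) (s t : R) : mu.-integrable I (EFin \o h) -> -1 <= s -> s < t ->
    t <= 0 -> \int[mu]_(r in `]-1, t]) h r =
    \int[mu]_(r in `]-1, s]) h r + \int[mu]_(r in `]s, t]) h r.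
  move=> ih s1 st t0; rewrite -(@Rintegral_itvB _ h (BRight (-1)) (BRight t) s).
  - by rewrite addrC subrK.
  - exact: iS.
  - by rewrite bnd_simp.
  - by rewrite bnd_simp ltW.
have loc (e s t : R) : -1 <= s -> s < t -> t <= 0 ->
    (forall r, s < r <= t -> `|F t + F s - 2 *: F r| <= e) ->
    `| `|F t| ^+ 2 - `|F s| ^+ 2 - 2 * \int[mu]_(r in `]s, t]) w r| <=
    e * \int[mu]_(r in `]s, t]) `|L2rep g r|.
  move=> s1 st t0 Fe.
  have mst : measurable (`]s, t]%classic : set R) by exact: measurable_itv.
  (* F t + F s becomes the fixed test vector of [weak_derivative_increment]; replacing it by 2 F r
     under the integral costs at most e |g r|. *)
  have -> : `|F t| ^+ 2 - `|F s| ^+ 2 = dot (F t - F s) (F t + F s).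
    by rewrite dotBl !dotDr -!X_hilbert (dotC dot (F s)); ring.
  rewrite (weak_derivative_increment _ fg)//.
  have i1 : mu.-integrable (`]s, t]%classic : set R)
      (EFin \o (fun r => dot (L2rep g r) (F t + F s))).
    by apply: iS => //; exact: integrable_dotI.
  have iw' := iS _ _ _ iw s1 t0; have ig' := iS _ _ _ ig s1 t0.
  have i2 : mu.-integrable (`]s, t]%classic : set R) (EFin \o (fun r => 2 * w r)).
    exact: integrable_mull.
  have i3 : mu.-integrable (`]s, t]%classic : set R) (EFin \o (fun r =>
      dot (L2rep g r) (F t + F s) - 2 * w r)) by exact: integrable_sub.
  rewrite -!RintegralZl// -RintegralB//.
  apply: (le_trans (le_normr_Rintegral _ _)) => //; apply: le_Rintegral => //.
  - exact: (integrable_norm i3).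
  - exact: integrable_mull.
  move=> r; rewrite /= in_itv/= => /Fe h.
  rewrite /w (dotC dot (F r)) -dotZr -dotNr -dotDr.
  apply: le_trans (dot_le X_hilbert _ _) _; rewrite mulrC ler_wpM2r//.
have main (e : R) : 0 < e ->
    `| `|F 0| ^+ 2 - `|F (-1)| ^+ 2 - 2 * \int[mu]_(r in I) w r| <=
    e * \int[mu]_(r in I) `|L2rep g r|.
  move=> e0.
  (* The guard u <= 1 is part of [P] because real induction runs over the whole half-line. *)
  pose P (u : R) := u <= 1 -> `| `|F (-1 + u)| ^+ 2 - `|F (-1)| ^+ 2 -
    2 * \int[mu]_(r in `]-1, -1 + u]) w r| <=
    e * \int[mu]_(r in `]-1, -1 + u]) `|L2rep g r|.
  have step (u v : R) : 0 <= u -> u < v -> v <= 1 -> P u ->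
      (forall r, -1 + u < r <= -1 + v -> `|F (-1 + v) + F (-1 + u) - 2 *: F r| <= e) -> P v.
    move=> u0 uv v1 Pu huv _.
    have l1 : -1 <= -1 + u by lra.
    have l2 : -1 + u < -1 + v by lra.
    have l3 : -1 + v <= 0 by lra.
    have h1 := Pu (ltW (lt_le_trans uv v1)); have h2 := loc _ _ _ l1 l2 l3 huv.
    rewrite (split w (-1 + u) (-1 + v) iw l1 l2 l3) (split _ (-1 + u) (-1 + v) ig l1 l2 l3).
    rewrite [leRHS]mulrDr; apply: le_trans (lerD h1 h2); apply: le_trans (ler_normD _ _).
    by rewrite le_eqVlt; apply/orP; left; apply/eqP; congr (`| _ |); ring.
  have near_F (u : R) : exists2 d, 0 < d & forall a b c, `|u - a| < d ->
      `|u - b| < d -> `|u - c| < d -> `|F a + F b - 2 *: F c| <= e.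
    (* F a + F b - 2 F c is a combination of four deviations from F u. *)
    have e4 : 0 < e / 4 by rewrite divr_gt0.
    have /cvgrPdist_le/(_ _ e4)[d /= d0 hd] := cF u.
    exists d => // a b c /hd ha /hd hb /hd hc.
    rewrite (_ : _ - _ = (F u - F c) + (F u - F c) - ((F u - F a) + (F u - F b))).
      apply: le_trans (ler_normB _ _) _.
      have := ler_normD (F u - F c) (F u - F c).
      by have := ler_normD (F u - F a) (F u - F b); lra.
    have tri (p q z : X) : q - z + (p - q) = p - z by rewrite addrC addrA subrK.
    rewrite opprD !opprB addrACA !tri.
    by rewrite addrACA -opprD scaler_nat mulr2n.
  have P1 : P 1.
    apply: real_induction ler01.
    - move=> _; rewrite addr0 !subrr.
      rewrite set_itv_ge ?bnd_simp// ?ltxx// !Rintegral_set0 !mulr0 subrr normr0.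
      by [].
    - move=> u u0 Pu; have [d d0 hd] := near_F (-1 + u).
      exists (d / 2); first by rewrite divr_gt0.
      move=> h /andP[]; rewrite le_eqVlt => /predU1P[<- _|h0 hd2]; first by rewrite addr0.
      have [uh1|uh1] := leP (u + h) 1; last by move=> /(lt_le_trans uh1); rewrite ltxx.
      apply: (step u) => //; first by rewrite ltrDl.
      move=> r /andP[r1 r2]; apply: hd; rewrite ltr_norml; apply/andP; split;
        by clear - d0 h0 hd2 r1 r2; lra.
    - move=> u u0 Pu u1; have [d d0 hd] := near_F (-1 + u).
      (* The limit case takes no limit: [s] lies so close to [u] that a single step from [s] reaches
         [u]. *)
      pose s := Num.max 0 (u - d / 2).
      have s0 : 0 <= s by rewrite le_max lexx.
      have su : s < u by rewrite gt_max u0 ltrBlDr ltrDl divr_gt0.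
      have sd : u - d / 2 <= s by rewrite le_max lexx orbT.
      apply: (step s) => //; first by apply: Pu; rewrite s0.
      move=> r /andP[r1 r2]; apply: hd; rewrite ltr_norml; apply/andP; split;
        by clear - d0 su sd r1 r2; lra.
  have := P1 (lexx 1); rewrite addNr !Rintegral_itv_obnd_cbnd//.
  - exact: iS.
  - exact: iS.
pose C := \int[mu]_(r in I) `|L2rep g r|.
have C0 : 0 <= C by exact: Rintegral_ge0.
apply/eqP; rewrite eq_sym -subr_eq0 -normr_eq0 eq_le normr_ge0 andbT.
apply/ler_addgt0Pr => e e0; rewrite add0r.
have C1 : 0 < 1 + C by rewrite ltr_wpDr.
apply: le_trans (main (e / (1 + C)) (divr_gt0 e0 C1)) _.
rewrite -/C mulrAC ler_pdivrMr// ler_wpM2l ?(ltW e0)// lerDr.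
by [].
Qed.

End Energy.

(** * Density of the domain of the delay operator *)

Section DelayDomainDense.
Context {R : realType} {X : completeNormedModType R} (dot : {dot X for idfun}).
Hypothesis X_hilbert : norm_of_dot dot.
Variable DA : set X.
Hypothesis DA_dense : forall x (e : R), 0 < e -> exists2 z, DA z & `|x - z| <= e.
Hypothesis DA_scale : forall a x, DA x -> DA (a *: x).
Hypothesis domain_linear : forall a u v, delay_domain DA u -> delay_domain DA v ->
  delay_domain DA (a *: u + v).
Local Notation mu := (@lebesgue_measure R).
Local Notation I := (`[-1, 0]%classic : set R).
Let mI := @measurable_delay_itv R.
Let muI := @lebesgue_delay_itv_lty R.
Implicit Types (u v : delay_space X) (f g : R -> X).

Lemma delay_norm_leD u : `|u| <= `|u.1| + `|u.2|.
Proof.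
change (Num.sqrt (`|u.1| ^+ 2 + `|u.2| ^+ 2) <= `|u.1| + `|u.2|).
rewrite -[leRHS]ger0_norm ?addr_ge0// -sqrtr_sqr ler_sqrt ?sqr_ge0//.
have := normr_ge0 u.1; have := normr_ge0 u.2.
by move: (`|u.1|) (`|u.2|) => a b; nra.
Qed.

(** Membership in the closure of the delay domain, which is shown to be a closed subspace and then
    to contain enough elements. *)
Let approx u := forall e : R, 0 < e -> exists2 v, delay_domain DA v & `|u - v| <= e.

Let approx_domain u : delay_domain DA u -> approx u.
Proof. by move=> Du e e0; exists u => //; rewrite subrr normr0 ltW. Qed.

Let approx_linear a u v : approx u -> approx v -> approx (a *: u + v).
Proof.
move=> au av e e0; have a1 : 0 < 1 + `|a| by rewrite ltr_wpDr.
have e1 : 0 < e / 2 / (1 + `|a|) by rewrite !divr_gt0.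
have e2 : 0 < e / 2 by rewrite divr_gt0.
have [u' Du hu] := au _ e1; have [v' Dv hv] := av _ e2.
exists (a *: u' + v'); first exact: domain_linear.
rewrite opprD addrACA -scalerBr; apply: le_trans (ler_normD _ _) _.
rewrite [leRHS]splitr; apply: lerD; last exact: hv.
rewrite normrZ.
apply: le_trans (_ : (1 + `|a|) * (e / 2 / (1 + `|a|)) <= _).
  by apply: ler_pM => //; rewrite lerDr.
by rewrite mulrC divfK// gt_eqF.
Qed.

Let approx_closed u : (forall e : R, 0 < e -> exists2 v, approx v & `|u - v| <= e) ->
  approx u.
Proof.
move=> au e e0; have e2 : 0 < e / 2 by rewrite divr_gt0.
have [v av uv] := au _ e2; have [w Dw vw] := av _ e2.
exists w => //; rewrite [leRHS]splitr.
rewrite (_ : u - w = (u - v) + (v - w)); last by rewrite addrA subrK.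
by apply: le_trans (ler_normD _ _) _; apply: lerD.
Qed.

(** Stated for functions instead of classes, so that pointwise identities and pointwise limits can
    be used. *)
Let approxL2 f := exists2 F : L2fun X, L2val F = f & approx (0, L2class F).

Let approxL2_linear a f g : approxL2 f -> approxL2 g ->
  approxL2 (fun t => a *: f t + g t).
Proof.
move=> [F <- aF] [G <- aG]; exists (a *: F + G); first exact: erefl.
rewrite L2classD L2classZ.
have := approx_linear a aF aG; congr approx.
by congr pair; rewrite /= scaler0 addr0.
Qed.

Let approxL2_dominated (f_ : nat -> R -> X) f (h : R -> R) :
  (forall n, approxL2 (f_ n)) -> strongly_measurable I f ->
  (forall t, I t -> f_ n t @[n --> \oo] --> f t) ->
  mu.-integrable I (EFin \o (fun t => h t ^+ 2)) ->
  (forall n t, I t -> `|f_ n t| <= h t) -> approxL2 f.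
Proof.
move=> af mf cf ih fh.
have f_h t : I t -> `|f t| <= h t.
  move=> It; have c : `|f_ n t| @[n --> \oo] --> `|f t| by apply: cvg_norm; exact: cf.
  by apply: (ler_cvg_to c (cvg_cst (h t))); apply: nearW => n; exact: fh.
have [F FE] : exists F : L2fun X, L2val F = f.
  apply: L2fun_exists => //.
  apply: (@integrable_dominated _ _ R mu I mI _ (fun t => h t ^+ 2)) => //.
    by apply: measurable_funX; exact: strongly_measurable_norm.
  move=> t It; rewrite ger0_norm ?sqr_ge0// lerXn2r ?nnegrE//; last exact: f_h.
  by rewrite (le_trans _ (f_h t It)).
exists F => //; apply: approx_closed => e e0.
pose F_ n := projT1 (cid2 (af n)).
have F_E n : L2val (F_ n) = f_ n by rewrite /F_; case: cid2.
have aF_ n : approx (0, L2class (F_ n)) by rewrite /F_; case: cid2.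
(* Since |f_n| and |f| are at most h, the squared difference is at most (2 h)^2. *)
have ih4 : mu.-integrable I (EFin \o (fun t => 4 * h t ^+ 2)) by exact: integrable_mull.
have cF : L2class (F_ n) @[n --> \oo] --> L2class F.
  apply: (L2class_dominated (g := fun t => 4 * h t ^+ 2)) => //.
    by move=> t It; rewrite FE; under eq_fun do rewrite F_E; exact: cf.
  move=> n t It; rewrite F_E FE.
  have h1 := ler_normB (f_ n t) (f t); have h2 := fh n t It; have h3 := f_h t It.
  have h0 : `|f_ n t - f t| <= 2 * h t by lra.
  rewrite (_ : 4 * _ = (2 * h t) ^+ 2); last by ring.
  by rewrite lerXn2r ?nnegrE// (le_trans _ h0).
move/cvgrPdist_le: cF => /(_ _ e0)[n _ /(_ n (leqnn n)) hn].
exists (0, L2class (F_ n)) => //.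
apply: le_trans (delay_norm_leD _) _.
by rewrite /= subr0 normr0 add0r.
Qed.

Let approxL2_eq f g : approxL2 f -> f = g -> approxL2 g.
Proof. by move=> af <-. Qed.

(** A boundary layer rising from 0 to 1 on [-1/(n+1), 0]: its trace at 0 is always 1 while its L2
    norm on [-1, 0] tends to 0. *)
Let step_at0 (n : nat) (t : R) : R := smooth_step (n.+1%:R * (t - (- n.+1%:R^-1))).

Let step_at00 n : step_at0 n 0 = 1.
Proof. by rewrite /step_at0 sub0r opprK mulfV// smooth_step_ge1. Qed.

Let step_at0_cvg t : I t ->
  step_at0 n t @[n --> \oo] --> (\1_(`[0, +oo[%classic : set R) t : R).
Proof.
rewrite /= in_itv/= => /andP[_]; rewrite le_eqVlt => /predU1P[->|t0].
  under eq_fun do rewrite step_at00.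
  rewrite indicE mem_set/=; last by rewrite in_itv/= lexx.
  exact: cvg_cst.
rewrite indicE memNset/=; last by rewrite in_itv/= andbT leNgt t0.
apply: cvg_near_cst; near=> n; apply: smooth_step_le0; rewrite opprK mulrDr mulfV//.
have [n0 nt] : 0 < n%:R :> R /\ (n%:R^-1 : R) < - t.
  by near: n; apply: near_infty_inv_lt; rewrite oppr_gt0.
have : 1 < - t * n%:R by rewrite -ltr_pdivrMr// mul1r.
by rewrite -natr1 mulrDl mul1r; lra.
Unshelve. all: by end_near. Qed.

Let L2class0 : L2class 0 = 0 :> L2 X.
Proof. by apply: (addrI (L2class 0)); rewrite -L2classD !addr0. Qed.

(** For x in [DA], the pairs of x and its boundary layer [step_at0 n *: x] lie in the domain and
    tend to (x, 0). Density of [DA] gives the general case. *)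
Let approx_fst x : approx (x, 0).
Proof.
suff {x} aDA x : DA x -> approx (x, 0).
  apply: approx_closed => e e0; have [z Dz xz] := DA_dense x e0.
  exists (z, 0); first exact: aDA.
  by apply: le_trans (delay_norm_leD _) _; rewrite /= subrr normr0 addr0.
move=> Dx.
have HF n : exists2 F : L2fun X, L2val F = (fun t => step_at0 n t *: x) &
    delay_domain DA (x, L2class F).
  have [F [FE HF /(_ 0) VF]] := @smooth_scale_H1 R X dot X_hilbert (step_at0 n) _ x
    (@is_derive_scaled_step R n.+1%:R (- n.+1%:R^-1))
    (@continuous_scaled_bump R n.+1%:R (- n.+1%:R^-1)).
  by exists F => //; split => //=; move: VF; rewrite step_at00 scale1r.
pose F n := projT1 (cid2 (HF n)).
have FE n : L2val (F n) = (fun t => step_at0 n t *: x) by rewrite /F; case: cid2.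
have DF n : delay_domain DA (x, L2class (F n)) by rewrite /F; case: cid2.
pose f0 (t : R) := (\1_(`[0, +oo[%classic : set R) t : R) *: x.
have mf0 : strongly_measurable I f0.
  by apply: strongly_measurable_scale => //; exact: strongly_measurable_cst.
have le1 (a : R) : 0 <= a -> a <= 1 -> `|a *: x| <= `|x|.
  by move=> a0 a1; rewrite normrZ ger0_norm// ler_piMl.
have ic : mu.-integrable I (EFin \o (fun=> `|x| ^+ 2)).
  by apply: (@integrable_bounded _ _ R mu I mI _ (`|x| ^+ 2)) => // t _; rewrite ger0_norm.
have ind01 t : 0 <= (\1_(`[0, +oo[%classic : set R) t : R) <= 1.
  by rewrite indicE; case: (_ \in _); rewrite /= ?lexx ?ler01.
have [F0 F0E] : exists F : L2fun X, L2val F = f0.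
  apply: L2fun_exists => //.
  apply: (@integrable_dominated _ _ R mu I mI _ (fun=> `|x| ^+ 2)) => //.
    by apply: measurable_funX; exact: strongly_measurable_norm.
  move=> t It; rewrite ger0_norm// lerXn2r ?nnegrE//.
  by have /andP[? ?] := ind01 t; exact: le1.
have cF : L2class (F n) @[n --> \oo] --> L2class F0.
  apply: (L2class_dominated (g := fun t => 4 * `|x| ^+ 2)) => //.
  - move=> t It; rewrite F0E; under eq_fun do rewrite FE.
    by apply: cvgZr_tmp; exact: step_at0_cvg.
  - exact: integrable_mull.
  move=> n t It; rewrite FE F0E.
  have h1 := ler_normB (step_at0 n t *: x) (f0 t).
  have h2 := le1 _ (smooth_step_ge0 (n.+1%:R * (t - (- n.+1%:R^-1)))) (smooth_step_le1 _).
  have h3 : `|f0 t| <= `|x| by have /andP[? ?] := ind01 t; exact: le1.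
  have h0 : `|step_at0 n t *: x - f0 t| <= 2 * `|x| by rewrite /step_at0 in h1 *; lra.
  rewrite (_ : 4 * _ = (2 * `|x|) ^+ 2); last by ring.
  by rewrite lerXn2r ?nnegrE// (le_trans _ h0).
(* On [-1, 0] the pointwise limit [f0] can be nonzero only at t = 0, a null set. *)
have F00 : L2class F0 = 0.
  rewrite -L2class0; apply/L2classP; exists [set 0]; split.
  - exact: measurable_set1.
  - exact: lebesgue_measure_set1.
  move=> t /= h; apply: contrapT => t0; apply: h.
  rewrite in_itv/= F0E => /andP[_ t0'].
  change (f0 t = 0); rewrite /f0 indicE memNset ?scale0r//= in_itv/= andbT => t1.
  by apply: t0; apply/eqP; rewrite eq_le t1 t0'.
rewrite F00 in cF.
move=> e e0; move/cvgrPdist_le: cF => /(_ _ e0)[n _ /(_ n (leqnn n)) hn].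
exists (x, L2class (F n)) => //.
by apply: le_trans (delay_norm_leD _) _; rewrite /= subrr normr0 add0r.
Qed.

Let approxL2_0 : approxL2 (fun=> 0).
Proof.
exists 0 => //; rewrite L2class0.
have := approx_linear (-1) (approx_fst 0) (approx_fst 0).
by rewrite scaleN1r addNr.
Qed.

(** For z in [DA], the pair (phi 0 z, phi z) is in the domain, and subtracting (phi 0 z, 0), which
    is in the closure, frees the function from its trace. A general y is a limit of such z. *)
Let approxL2_smooth (phi phi' : R -> R) (y : X) :
  (forall t : R, is_derive t 1 phi (phi' t)) -> continuous phi' ->
  approxL2 (fun t => phi t *: y).
Proof.
move=> dphi cphi'.
have cphi : continuous phi.
  move=> t; apply/differentiable_continuous/derivable1_diffP.
  by have [] := dphi t.
have [M hM] := continuous_bounded_itv cphi.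
have aDA z : DA z -> approxL2 (fun t => phi t *: z).
  move=> Dz; have [F [FE HF /(_ 0) VF]] := smooth_scale_H1 X_hilbert z dphi cphi'.
  exists F => //.
  have DF : delay_domain DA (phi 0 *: z, L2class F) by split => //=; exact: DA_scale.
  have := approx_linear (-1) (approx_fst (phi 0 *: z)) (approx_domain DF).
  by congr approx; congr pair; rewrite /= scaleN1r ?addNr ?oppr0 ?add0r.
have HY n : exists2 z, DA z & `|y - z| <= n.+1%:R^-1.
  by apply: DA_dense; rewrite invr_gt0.
pose Y n := projT1 (cid2 (HY n)).
have DY n : DA (Y n) by rewrite /Y; case: cid2.
have YE n : `|y - Y n| <= n.+1%:R^-1 by rewrite /Y; case: cid2.
have cY : Y n @[n --> \oo] --> y.
  apply/cvgrPdist_le => e e0; have := near_infty_inv_lt e0; apply: filterS => n [n0 ne].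
  apply: le_trans (YE n) _; apply/ltW; apply: le_lt_trans ne.
  by rewrite lef_pV2 ?posrE// ler_nat.
apply: (@approxL2_dominated (fun n t => phi t *: Y n) _ (fun=> M * (`|y| + 1))).
- by move=> n; exact: aDA.
- apply: strongly_measurable_scale => //; last exact: strongly_measurable_cst.
  by apply: measurable_funTS; exact: continuous_measurable_fun.
- by move=> t _; apply: cvgZl_tmp.
- by apply: (@integrable_bounded _ _ R mu I mI _ ((M * (`|y| + 1)) ^+ 2)) => // t _;
    rewrite ger0_norm// sqr_ge0.
move=> n t It; rewrite normrZ; apply: ler_pM => //; first exact: hM.
rewrite (_ : Y n = y - (y - Y n)); last by rewrite opprB addrC subrK.
apply: le_trans (ler_normB _ _) _; rewrite lerD2l.
by apply: le_trans (YE n) _; rewrite invf_le1// ler1n.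
Qed.

Let strongly_measurable_indic (A : set R) (y : X) : measurable A ->
  strongly_measurable I (fun t => (\1_A t : R) *: y).
Proof.
by move=> mA; apply: strongly_measurable_scale => //; exact: strongly_measurable_cst.
Qed.

Let approxL2_bounded (f_ : nat -> R -> X) f (M : R) :
  (forall n, approxL2 (f_ n)) -> strongly_measurable I f ->
  (forall t, I t -> f_ n t @[n --> \oo] --> f t) ->
  (forall n t, I t -> `|f_ n t| <= M) -> approxL2 f.
Proof.
move=> af mf cf fM; apply: (@approxL2_dominated f_ f (fun=> M)) => //.
by apply: (@integrable_bounded _ _ R mu I mI _ (M ^+ 2)) => // t _;
  rewrite ger0_norm// sqr_ge0.
Qed.

Let approxL2_ray (x : R) (y : X) :
  approxL2 (fun t => (\1_(`]x, +oo[%classic : set R) t : R) *: y).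
Proof.
apply: (@approxL2_bounded (fun n t => smooth_step (n%:R * (t - x)) *: y) _ `|y|).
- move=> n; apply: (@approxL2_smooth (fun t => smooth_step (n%:R * (t - x)))
      (fun t => n%:R * smooth_bump (n%:R * (t - x)))).
    exact: is_derive_scaled_step.
  exact: continuous_scaled_bump.
- by apply: strongly_measurable_indic; exact: measurable_itv.
- by move=> t _; apply: cvgZr_tmp; exact: scaled_step_cvg.
move=> n t _; rewrite normrZ ger0_norm ?smooth_step_ge0//.
by rewrite ler_piMl// smooth_step_le1.
Qed.

(** Dynkin's theorem: open rays are stable under intersection and generate the Borel sets.
    Complements follow by linearity, disjoint unions from partial sums, which are indicators and so
    stay bounded by |y| after scaling. *)
Let approxL2_indic (A : set R) (y : X) : measurable A ->
  approxL2 (fun t => (\1_A t : R) *: y).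
Proof.
pose P (A : set R) := approxL2 (fun t => (\1_A t : R) *: y).
have PT : P setT.
  have d1 (t : R) : is_derive t 1 (cst 1 : R -> R) ((cst 0 : R -> R) t) by exact: is_derive_cst.
  apply: (approxL2_eq (approxL2_smooth y d1 (fun=> cvg_cst _))).
  by apply/funext => t; rewrite indicT.
move=> mA; change (P A).
apply: (@dynkin_induction _ (measurableTypeR R) (@RGenOInfty.G R) P).
- exact: RGenOInfty.measurableE.
- move=> _ _ [x ->] [z ->]; exists (Num.max x z); apply/seteqP; split=> t /=;
    by rewrite !in_itv/= !andbT gt_max => /andP.
- exact: PT.
- by move=> _ [x ->]; exact: approxL2_ray.
- move=> S mS PS; apply: approxL2_eq (approxL2_linear (-1) PS PT) _.
  apply/funext => t; rewrite scalerA -scalerDl; congr (_ *: _).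
  by rewrite !indicE in_setC in_setT; case: (t \in S); rewrite /=; ring.
- move=> F mF tF PF.
  have sumE n t : \sum_(k < n) (\1_(F k) t : R) = \1_(\bigcup_(k < n) F k) t.
    have [[k /= kn Fkt]|nF] := pselect ((\bigcup_(k < n) F k) t).
      rewrite [RHS]indicE mem_set; last by exists k.
      rewrite (bigD1 (Ordinal kn))//= indicE mem_set// big1 ?addr0// => j jk.
      rewrite indicE memNset// => Fjt; move/negP: jk; apply.
      by apply/eqP/val_inj => /=; apply: (tF j k) => //; exists t.
    rewrite [RHS]indicE memNset// big1// => j _.
    by rewrite indicE memNset// => Fjt; apply: nF; exists j => //=; exact: ltn_ord.
  apply: (@approxL2_bounded (fun n t => (\sum_(k < n) (\1_(F k) t : R)) *: y) _ `|y|).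
  - elim=> [|n IH].
      by apply: approxL2_eq approxL2_0 _; apply/funext => t; rewrite big_ord0 scale0r.
    apply: approxL2_eq (approxL2_linear 1 IH (PF n)) _.
    by apply/funext => t; rewrite scale1r -scalerDl big_ord_recr.
  - by apply: strongly_measurable_indic; exact: bigcupT_measurable.
  - move=> t _; apply: cvgZr_tmp; apply: cvg_near_cst.
    have [[k _ Fkt]|nF] := pselect ((\bigcup_k F k) t).
      exists k.+1 => // n /= kn; rewrite sumE !indicE !mem_set//; first by exists k.
      by exists k.
    apply: nearW => n; rewrite sumE !indicE !memNset// => -[k _ Fkt]; apply: nF;
      by exists k.
  move=> n t _; rewrite sumE normrZ indicE.
  by case: (_ \in _); rewrite /= ?normr1 ?normr0 ?mul1r ?mul0r.
by have : (@ocitv R).-sigma.-measurable A by []; rewrite RGenOInfty.measurableE.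
Qed.

Let approxL2_simple (s : R -> X) : is_simple s -> approxL2 s.
Proof.
move=> [fs ms].
have E : (fun t => \sum_(x <- fset_set (range s)) (\1_(s @^-1` [set x]) t : R) *: x) = s.
  apply/funext => t.
  have st : s t \in fset_set (range s) by rewrite in_fset_set//; apply: mem_set; exists t.
  rewrite (bigD1_seq (s t))//= ?fset_uniq// big1 ?addr0; last first.
    move=> x xs; rewrite indicE memNset ?scale0r// => /= sx.
    by rewrite sx eqxx in xs.
  by rewrite indicE mem_set// scale1r.
suff H (l : seq X) : approxL2 (fun t => \sum_(x <- l) (\1_(s @^-1` [set x]) t : R) *: x).
  exact: approxL2_eq (H _) E.
elim: l => [|x l IH].
  by apply: approxL2_eq approxL2_0 _; apply/funext => t; rewrite big_nil.
apply: approxL2_eq (approxL2_linear 1 (approxL2_indic x (ms x)) IH) _.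
by apply/funext => t; rewrite big_cons scale1r.
Qed.

Let approx_snd (F : L2fun X) : approx (0, L2class F).
Proof.
have mF := L2fun_measurable F.
have [s_ [ss cs bs]] := strongly_measurable_dominated mI mF.
have [G GF aG] : approxL2 F.
  apply: (@approxL2_dominated s_ F (fun t => 2 * `|F t|)) => //.
    by move=> n; exact: approxL2_simple.
  have -> : (fun t => (2 * `|F t|) ^+ 2) = (fun t => 2 ^+ 2 * `|F t| ^+ 2).
    by apply/funext => t; rewrite exprMn.
  by apply: integrable_mull => //; exact: integrable_sqr_L2.
by have -> : F = G by apply: val_inj.
Qed.

Lemma delay_domain_dense u (e : R) : 0 < e ->
  exists2 v, delay_domain DA v & `|u - v| <= e.
Proof.
move: e; change (approx u).
have := approx_linear 1 (approx_fst u.1) (approx_snd (L2rep u.2)).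
by rewrite L2repK scale1r; case: u => x f; congr approx; congr pair; rewrite /= ?addr0 ?add0r.
Qed.

End DelayDomainDense.

(** * Growth of the delay semigroup *)

(** For r > 0, <T r x - x, x> <= |T r x| |x| - |x|^2 <= 0; the sign survives division by r and the
    limit. *)
Lemma contraction_generator_dissipative (R : realType) (X : normedModType R)
    (dot : {dot X for idfun}) (X_hilbert : norm_of_dot dot)
    (T : R -> {linear X -> X}) (D : set X) (A : X -> X) x :
  C0_semigroup T -> (forall t, 0 <= t -> opnorm (T t) <= 1) ->
  generates T D A -> D x -> dot (A x) x <= 0.
Proof.
move=> T_semigroup T1 T_generator Dx.
have /T_generator h : D x /\ A x = A x by [].
have c : dot (r^-1 *: (T r x - x)) x @[r --> 0^'+] --> dot (A x) x by exact: dot_cvgl.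
apply: (ler_cvg_to c (cvg_cst 0)); near=> r.
have r0 : 0 < r by near: r; exact: nbhs_right_gt.
rewrite dotZl pmulr_rle0 ?invr_gt0// dotBl subr_le0.
apply: le_trans (ler_norm _) _; apply: le_trans (dot_le X_hilbert _ _) _.
rewrite -X_hilbert expr2 ler_wpM2r//.
apply: le_trans (opnorm_bound _ (C0_bounded T_semigroup (ltW r0))) _.
by rewrite ler_piMl// T1 ?ltW.
Unshelve. all: by end_near. Qed.

(** The arithmetic of one small time step, to be read with x = |TT h u|, n = |u|, c = |B u|, N = |u
    + h B u| and h eta the error of the first-order expansion. The second-order term and the error
    term each use half of e h. *)
Lemma sqr_le_perturbed (R : realType) (x n c N e h eta W : R) :
  0 <= x -> 0 <= n -> 0 <= c -> 0 < h <= 1 -> 0 < eta <= 1 ->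
  4 * (n + c + 1) * eta <= e -> 2 * (c ^+ 2 + 1) * h <= e ->
  x <= N + h * eta -> N <= n + h * c -> N ^+ 2 <= W + h ^+ 2 * c ^+ 2 ->
  x ^+ 2 <= W + e * h.
Proof.
move=> x0 n0 c0 /andP[h0 h1] /andP[eta0 eta1] etae hc N1 N2 N3.
apply: (@le_trans _ _ ((N + h * eta) ^+ 2)).
  by rewrite lerXn2r ?nnegrE// (le_trans x0).
have h2 : h * c <= c by rewrite ler_piMl.
have h3 : h * (2 * (c ^+ 2 + 1) * h) <= h * e by rewrite ler_pM2l.
have h4 : h * (4 * (n + c + 1) * eta) <= h * e by rewrite ler_pM2l.
have h9 : 0 <= h * eta by rewrite mulr_ge0 ?ltW.
have h5 : h * eta * N <= h * eta * (n + c).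
  by apply: ler_wpM2l => //; apply: le_trans N2 _; rewrite lerD2l.
have h6 : h * h * (eta * eta) <= h * eta.
  have i1 : h * h <= h by rewrite ler_piMl// ltW.
  have i2 : eta * eta <= eta by rewrite ler_piMl// ltW.
  by apply: ler_pM => //; rewrite mulr_ge0// ltW.
have h7 : 0 <= h * h by rewrite mulr_ge0 ?ltW.
lra.
Qed.

Lemma growth_step_le (R : realType) (h s w m : R) : 0 <= h -> s <= w * m ->
  m + 2 * h * s <= m * (1 + 2 * w * h).
Proof. by move=> h0 sm; have := ler_wpM2l h0 sm; lra. Qed.

Section DelaySemigroup.
Context {R : realType} {X : completeNormedModType R} (dot : {dot X for idfun}).
Hypothesis X_hilbert : norm_of_dot dot.
Context (DA : set X) (A : X -> X) (A1 : {linear X -> X}).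
Hypothesis A_dissipative : forall x, DA x -> dot (A x) x <= 0.
Hypothesis A1_bounded : continuous A1.
Local Notation mu := (@lebesgue_measure R).
Local Notation I := (`[-1, 0]%classic : set R).
Implicit Types u v : delay_space X.

Let w := (1 + opnorm A1 ^+ 2) / 2.

Let B u := delay_A0 A u + delay_APsi (delay_Psi A1) u.

Lemma sqr_delay_norm u : `|u| ^+ 2 = `|u.1| ^+ 2 + `|u.2| ^+ 2.
Proof.
change (delay_norm u ^+ 2 = `|u.1| ^+ 2 + `|u.2| ^+ 2).
by rewrite sqr_sqrtr// addr_ge0 ?sqr_ge0.
Qed.

Lemma sqr_delay_normD u v (h : R) : `|u + h *: v| ^+ 2 = `|u| ^+ 2 +
  2 * h * (dot u.1 v.1 + \int[mu]_(t in I) dot (L2rep u.2 t) (L2rep v.2 t)) +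
  h ^+ 2 * `|v| ^+ 2.
Proof.
rewrite (sqr_delay_norm (u + h *: v)) (sqr_delay_norm u) (sqr_delay_norm v) /=.
rewrite (sqr_norm_L2D X_hilbert) (dot_sqrD X_hilbert).
rewrite (dotZr dot) normrZ exprMn real_normK ?num_real//.
move: (`|u.1|) (`|u.2|) (`|v.1|) (`|v.2|) => a b c d; ring.
Qed.

(* The boundary term [- |f(-1)|^2 / 2] of the shift absorbs the delay term. *)
Lemma delay_dissipative u : delay_domain DA u ->
  dot u.1 (B u).1 + \int[mu]_(t in I) dot (L2rep u.2 t) (L2rep (B u).2 t) <=
  w * `|u| ^+ 2.
Proof.
move: u => [x f] [/= Dx Hf Vf].
have I0 : I 0 by rewrite /= in_itv/= lerN10 lexx.
have I1 : I (-1) by rewrite /= in_itv/= lexx lerN10.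
have [F [cF fF F0]] := value_at_continuous I0 Vf.
have V1 : value_at f (-1) (F (-1)).
  by exists F; split => //; exact: continuous_subspaceT.
(* The delay term uses a value chosen by [xget]; it has to be the left boundary value occurring in
   the energy identity. *)
have E1 : H1_eval f (-1) = F (-1).
  have /(xgetPex 0) : exists y, value_at f (-1) y by exists (F (-1)).
  rewrite -/(H1_eval f (-1)) => V2.
  have [G [cG fG <-]] := value_at_continuous I1 V2.
  apply: continuous_ae_eq_left => //.
  have FF := ae_filter_ringOfSetsType mu.
  by apply: filterS2 fF fG => t h1 h2 It; rewrite -h1// h2.
have dfg : weak_derivative f (H1_deriv f) by exact: (xgetPex 0 Hf).
have := weak_derivative_energy X_hilbert dfg cF fF.
rewrite F0 /delay_Psi E1 addr0.
set J := Rintegral _ _ _ => EJ.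
rewrite sqr_delay_norm /= dotDr (dotC dot x (A x)).
have h1 := A_dissipative Dx.
have h2 : dot x (A1 (F (-1))) <= `|x| * (opnorm A1 * `|F (-1)|).
  apply: le_trans (ler_norm _) _; apply: le_trans (dot_le X_hilbert _ _) _.
  by rewrite ler_wpM2l// opnorm_bound.
(* Young's inequality in the form that consumes exactly |F (-1)|^2 / 2; [h4] then enlarges |x|^2 to
   |u|^2. *)
have h3 := sqr_ge0 (opnorm A1 * `|x| - `|F (-1)|).
have h4 := mulr_ge0 (ltW (ltr_pwDl ltr01 (sqr_ge0 (opnorm A1)))) (sqr_ge0 `|f|).
rewrite /w; nra.
Qed.

Context (TT : R -> {linear delay_space X -> delay_space X}).
Hypothesis TT_semigroup : C0_semigroup TT.
Hypothesis TT_generator : generates TT (delay_domain DA) B.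

(** TT h u = u + h B u + o(h); in the squared norm of u + h B u the linear term is bounded by
    [delay_dissipative], and the remainder fits into e h for small h. *)
Lemma delay_semigroup_derivative u (e : R) : delay_domain DA u -> 0 < e ->
  \forall h \near 0^'+, `|TT h u| ^+ 2 <= `|u| ^+ 2 * (1 + 2 * w * h) + e * h.
Proof.
move=> Du e0; have /TT_generator/cvgrPdist_le cB : delay_domain DA u /\ B u = B u by [].
have nu : 0 <= `|u| by exact: normr_ge0.
have nB : 0 <= `|B u| by exact: normr_ge0.
have [eta /andP[eta0 eta1] etae] : exists2 eta : R, 0 < eta <= 1 &
    4 * (`|u| + `|B u| + 1) * eta <= e.
  move: (`|u|) (`|B u|) nu nB => n c n0 c0.
  have nc : 0 < 4 * (n + c + 1) by lra.
  exists (Num.min 1 (e / (4 * (n + c + 1)))).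
    by rewrite lt_min ltr01 divr_gt0//= ge_min lexx.
  by rewrite mulrC -ler_pdivlMr// ge_min lexx orbT.
have hB := cB _ eta0.
have ec : 0 < e / (2 * (`|B u| ^+ 2 + 1)).
  move: (`|B u|) nB => c c0; apply: divr_gt0 => //.
  by apply: mulr_gt0 => //; rewrite ltr_wpDl// sqr_ge0.
near=> h.
have h0 : 0 < h by near: h; exact: nbhs_right_gt.
have h1 : h <= 1 by near: h; exact: nbhs_right_le.
have hc : 2 * (`|B u| ^+ 2 + 1) * h <= e.
  have : h <= e / (2 * (`|B u| ^+ 2 + 1)) by near: h; exact: nbhs_right_le.
  move: (`|B u|) nB => c c0.
  have c1 : 0 < 2 * (c ^+ 2 + 1) by apply: mulr_gt0 => //; rewrite ltr_wpDl// sqr_ge0.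
  by rewrite ler_pdivlMr// mulrC.
have hr : `|B u - h^-1 *: (TT h u - u)| <= eta by near: h; exact: hB.
apply: (@sqr_le_perturbed R _ `|u| `|B u| `|u + h *: B u| _ _ eta _
  (normr_ge0 _) nu nB _ _ etae hc).
- by apply/andP; split.
- by apply/andP; split.
- have -> : TT h u = (u + h *: B u) - h *: (B u - h^-1 *: (TT h u - u)).
    rewrite scalerBr scalerA mulfV ?gt_eqF// scale1r opprB.
    by rewrite addrACA subrr addr0 addrC subrK.
  apply: le_trans (ler_normB _ _) _.
  by rewrite lerD2l normrZ gtr0_norm// ler_wpM2l// ltW.
- by apply: le_trans (ler_normD _ _) _; rewrite normrZ gtr0_norm.
rewrite (sqr_delay_normD u (B u) h) lerD2r.
exact: (growth_step_le (ltW h0) (delay_dissipative Du)).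
Unshelve. all: by end_near. Qed.

Hypothesis DA_dense : forall x (e : R), 0 < e -> exists2 z, DA z & `|x - z| <= e.
Hypothesis DA_scale : forall a x, DA x -> DA (a *: x).

Lemma delay_semigroup_growth t u : 0 <= t -> `|TT t u| <= expR (w * t) * `|u|.
Proof.
move=> t0; have w0 : 0 <= w by rewrite divr_ge0// addr_ge0// sqr_ge0.
have cT := C0_bounded TT_semigroup t0.
have dom := generator_domain_linear TT_generator.
set E := expR _; have E0 : 0 <= E by exact: expR_ge0.
have K0 : 0 <= opnorm (TT t) by exact: opnorm_ge0.
apply/ler_addgt0Pr => e e0.
(* Replacing u by a nearby v of the domain costs (E + |TT t|) |u - v|. The norm of [TT t] is finite
   but not yet controlled, and it multiplies only this error; the 1 makes the divisor positive. *)
have EK : 0 < E + opnorm (TT t) + 1 by rewrite ltr_wpDl// addr_ge0.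
have e1 : 0 < e / (E + opnorm (TT t) + 1) by rewrite divr_gt0.
have [v Dv uv] := delay_domain_dense X_hilbert DA_dense DA_scale dom u e1.
have hv : `|TT t v| <= E * `|v|.
  exact: (semigroup_growth TT_semigroup TT_generator w0 delay_semigroup_derivative).
have huv : `|TT t u - TT t v| <= opnorm (TT t) * `|u - v|.
  by rewrite -linearB; exact: opnorm_bound.
have hvu : `|v| <= `|u| + `|u - v|.
  rewrite {1}(_ : v = u - (u - v)); last by rewrite opprB addrC subrK.
  exact: ler_normB.
have hu : `|TT t u| <= `|TT t v| + `|TT t u - TT t v|.
  rewrite {1}(_ : TT t u = TT t v + (TT t u - TT t v)); last by rewrite addrC subrK.
  exact: ler_normD.
have ruv : 0 <= `|u - v| by exact: normr_ge0.
move: hv huv hvu hu uv ruv.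
move: (`|TT t u|) (`|TT t v|) (`|TT t u - TT t v|) (`|u|) (`|v|) (`|u - v|).
move: (opnorm _) K0 EK e1 => K K0 EK _ x y z p q r hv huv hvu hu.
rewrite ler_pdivlMr// => hr r0.
have k1 : E * q <= E * (p + r) by rewrite ler_wpM2l.
lra.
Qed.

End DelaySemigroup.

(** With y = a^2 t / 2 and z = a sqrt t, exp y <= 1 + y exp y and y = z (z / 2), so one factor z
    yields the square root of t and the rest is bounded by an exponential. *)
Lemma growth_bound_le (R : realType) (a t : R) : 0 <= a -> 0 <= t <= 1 ->
  expR ((1 + a ^+ 2) / 2 * t) <=
  expR (t / 2) * (1 + a * (Num.sqrt 2 * expR (2 * a ^+ 2)) * Num.sqrt t).
Proof.
move=> a0 /andP[t0 t1].
rewrite (_ : (1 + a ^+ 2) / 2 * t = t / 2 + a ^+ 2 * t / 2); last by field.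
rewrite expRD ler_wpM2l ?expR_ge0//.
set r := Num.sqrt t; have r0 : 0 <= r by exact: sqrtr_ge0.
have rt : r ^+ 2 = t by rewrite sqr_sqrtr.
have r1 : r <= 1 by rewrite -(sqrtr1 R) ler_sqrt.
set y := a ^+ 2 * t / 2.
have a2 : 0 <= a ^+ 2 by exact: sqr_ge0.
have y0 : 0 <= y by rewrite /y divr_ge0// mulr_ge0.
(* This is 1 - y <= exp (- y), multiplied by exp y. *)
have h1 : expR y <= 1 + y * expR y.
  have := expR_ge1Dx (- y); rewrite expRN => h.
  have ey := expR_gt0 y.
  have : (1 - y) * expR y <= 1.
    apply: le_trans (_ : (expR y)^-1 * expR y <= 1); first by rewrite ler_wpM2r// ltW.
    by rewrite mulVf// gt_eqF.
  lra.
apply: le_trans h1 _; rewrite lerD2l.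
have s2 : 1 <= Num.sqrt 2 :> R by rewrite -[leLHS](sqrtr1 R) ler_sqrt// ler1n.
set z := a * r; have z0 : 0 <= z by rewrite mulr_ge0.
have zt : z ^+ 2 = a ^+ 2 * t by rewrite exprMn rt.
have az : a ^+ 2 * t <= a ^+ 2 by rewrite ler_piMr.
rewrite (_ : y * expR y = z * (z / 2 * expR y)); last by rewrite /y -zt; field.
rewrite (_ : a * _ * r = z * (Num.sqrt 2 * expR (2 * a ^+ 2))); last first.
  by rewrite /z; ring.
apply: ler_wpM2l => //; apply: (@le_trans _ _ (expR (2 * a ^+ 2))); last first.
  by rewrite ler_peMl ?expR_ge0.
(* z / 2 <= 1 + z^2 <= exp (z^2), and z^2 + y = 3 a^2 t / 2 <= 2 a^2 because t <= 1. *)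
apply: (@le_trans _ _ (expR (z ^+ 2) * expR y)).
  rewrite ler_wpM2r ?expR_ge0//; apply: le_trans (expR_ge1Dx _).
  by have := sqr_ge0 (z - 1); nra.
by rewrite -expRD ler_expR zt /y; lra.
Qed.

Theorem proposition3p3 (R : realType) (X : completeNormedModType R)
    (dot : {dot X for idfun}) (X_hilbert : norm_of_dot dot)
    (T : R -> {linear X -> X}) (DA : set X) (A : X -> X)
    (T_semigroup : C0_semigroup T)
    (T_contraction : forall t, 0 <= t -> opnorm (T t) <= 1)
    (T_generator : generates T DA A)
    (A1 : {linear X -> X}) (A1_bounded : continuous A1)
    (TT0 : R -> {linear delay_space X -> delay_space X})
    (TT0_semigroup : C0_semigroup TT0)
    (TT0_generator : generates TT0 (delay_domain DA) (delay_A0 A))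
    (TT : R -> {linear delay_space X -> delay_space X})
    (TT_semigroup : C0_semigroup TT)
    (TT_generator : generates TT (delay_domain DA)
      (fun u => delay_A0 A u + delay_APsi (delay_Psi A1) u)) :
  exists M : R, M <= Num.sqrt 2 * expR (2 * opnorm A1 ^+ 2) /\
    forall t, 0 <= t <= 1 ->
      opnorm (TT t) <= expR (t / 2) * (1 + opnorm A1 * M * Num.sqrt t).
Proof.
exists (Num.sqrt 2 * expR (2 * opnorm A1 ^+ 2)); split => // t t01.
have /andP[t0 _] := t01.
apply: le_trans (growth_bound_le (opnorm_ge0 A1_bounded) t01).
apply: opnorm_le => [|u]; first exact: expR_ge0.
apply: (delay_semigroup_growth X_hilbert (DA := DA) (A := A)) => //.
- by move=> x Dx; exact: (contraction_generator_dissipative X_hilbert T_semigroup).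
- by move=> x e e0; exact: (generator_domain_dense X_hilbert T_semigroup T_generator).
move=> a x Dx; rewrite -[_ *: _]addr0.
by apply: (generator_domain_linear T_generator) => //; exact: generator_domain0 T_generator.
Qed.
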